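(* Let $\Omega\subset\mathbb{R}^d$ be a compact convex region with positive Lebesgue measure, let $V\subset C(\Omega)\subset L_2(\Omega)$, let $\Psi$ be the Matérn kernel on $\Omega$ with smoothness $\nu>0$, and let $f=\{f(g):g\in V\}$ be a mean-zero Gaussian process with covariance function $K(g,g')=\int_\Omega\int_\Omega g(\mathbf{x})g'(\mathbf{x}')\Psi(\mathbf{x},\mathbf{x}')\,d\mathbf{x}\,d\mathbf{x}'$. Let $\lambda_1\ge\lambda_2\ge\dots>0$ and $\{\phi_j\}_{j\ge1}$ be the eigenvalues and $L_2(\Omega)$-orthonormal eigenfunctions of $\Psi$, and suppose the input functions are $g_j=\phi_j\in V$ for $j=1,\dots,n$. Let $\hat f(g)=\mathbb{E}[f(g)\mid f(g_1),\dots,f(g_n)]$. Then there exists a constant $C_1>0$ (independent of $n$ and $g$) such that for all $g\in V$, $$\mathbb{E}\left(f(g)-\hat f(g)\right)^2\le C_1\|g\|_{L_2(\Omega)}^2\,n^{-\frac{2\nu}{d}}.$$ Furthermore, there exists a constant $C_2>0$ (independent of $n$ and $g$) such that if $g\in V$ also satisfies $g\in\mathcal{N}_\Psi(\Omega)$, then $$\mathbb{E}\left(f(g)-\hat f(g)\right)^2\le C_2\|g\|_{\mathcal{N}_\Psi(\Omega)}^2\,n^{-\frac{4\nu}{d}}.$$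
   Context: The Matérn kernel with smoothness $\nu$ is $\Psi(\mathbf{x},\mathbf{x}')=\psi(\|\mathbf{x}-\mathbf{x}'\|_2)$ with $$\psi(r)=\frac{1}{\Gamma(\nu)2^{\nu-1}}(2\sqrt{\nu}\,r)^\nu B_\nu(2\sqrt{\nu}\,r)\ (r>0),\qquad \psi(0)=1,$$ where $B_\nu$ is the modified Bessel function of the second kind. The eigenvalues and eigenfunctions are those of the Mercer expansion $\Psi(\mathbf{x},\mathbf{x}')=\sum_{j\ge1}\lambda_j\phi_j(\mathbf{x})\phi_j(\mathbf{x}')$, i.e. of the integral operator $g\mapsto\int_\Omega g(\mathbf{x}')\Psi(\cdot,\mathbf{x}')\,d\mathbf{x}'$ on $L_2(\Omega)$. $\mathcal{N}_\Psi(\Omega)$ is the reproducing kernel Hilbert space on $\Omega$ associated with $\Psi$. When the matrix $\mathbf{K}_n=(K(g_j,g_k))_{j,k}$ is invertible, $\hat f(g)=\mathbf{k}_n(g)^T\mathbf{K}_n^{-1}\mathbf{y}_n$ with $\mathbf{k}_n(g)=(K(g,g_1),\dots,K(g,g_n))^T$ and $\mathbf{y}_n=(f(g_1),\dots,f(g_n))^T$. *)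

(* Defs.v *)
From HB Require Import structures.
From mathcomp Require Import all_boot all_order all_algebra.
From mathcomp Require Import all_classical all_reals all_analysis.

Set Implicit Arguments.
Unset Strict Implicit.
Unset Printing Implicit Defensive.

Import Order.TTheory GRing.Theory Num.Theory.
Import numFieldNormedType.Exports.

Local Open Scope classical_set_scope.
Local Open Scope ring_scope.

Section measurable_rV.
Context {d} {T : measurableType d} (n : nat).

Let coors : 'I_n -> 'rV[T]_n -> T := fun i x => x ord0 i.

Let rV_set0 : g_sigma_preimage coors set0.
Proof. exact: sigma_algebra0. Qed.

Let rV_setC A : g_sigma_preimage coors A -> g_sigma_preimage coors (~` A).
Proof. exact: sigma_algebraC. Qed.

Let rV_bigcup (F : _^nat) : (forall i, g_sigma_preimage coors (F i)) ->
  g_sigma_preimage coors (\bigcup_i (F i)).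
Proof. exact: sigma_algebra_bigcup. Qed.

(* The product sigma-algebra, as for n.-tuple T in the library; rows are used
   because they also carry the vector space structure and the topology. *)
HB.instance Definition _ := @isMeasurable.Build (measure_tuple_display d)
  'rV[T]_n (g_sigma_preimage coors) rV_set0 rV_setC rV_bigcup.

Lemma measurable_coord (i : 'I_n) :
  measurable_fun [set: 'rV[T]_n] (fun x : 'rV[T]_n => x ord0 i).
Proof.
move=> _ Y mY; rewrite setTI; apply: sub_sigma_algebra => /=.
rewrite -bigcup_seq/=; exists i => /=; first by rewrite mem_index_enum.
by exists Y => //; rewrite setTI.
Qed.

Lemma measurable_fun_coordP d' (S : measurableType d') (f : S -> 'rV[T]_n) :
  (forall i, measurable_fun [set: S] (fun x => f x ord0 i)) ->
  measurable_fun [set: S] f.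
Proof.
move=> mf; pose G := image_set_system [set: S] f measurable.
suff sub : g_sigma_preimage coors `<=` G.
  by move=> _ A /sub; rewrite /G /image_set_system/= setTI.
apply: smallest_sub.
  by apply: sigma_algebra_image; exact: sigma_algebra_measurable.
rewrite -bigcup_seq => A [i _] [B mB <-].
rewrite /G /image_set_system/= !setTI.
by have := mf i measurableT B mB; rewrite setTI.
Qed.

End measurable_rV.

Section cons_row.
Context {R : realType} (n : nat).

Definition cons_row (p : R * 'rV[R]_n) : 'rV[R]_n.+1 :=
  \row_i (if unlift ord0 i is Some j then p.2 ord0 j else p.1).

Definition uncons_row (x : 'rV[R]_n.+1) : R * 'rV[R]_n :=
  (x ord0 ord0, \row_j x ord0 (lift ord0 j)).

Lemma cons_rowK : cancel cons_row uncons_row.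
Proof.
move=> [a x]; rewrite /uncons_row mxE unlift_none/=; congr pair.
by apply/rowP => j; rewrite !mxE liftK.
Qed.

Lemma measurable_cons_row : measurable_fun [set: R * 'rV[R]_n] cons_row.
Proof.
apply: measurable_fun_coordP => i.
case: (unliftP ord0 i) => [j ->|->].
- rewrite (_ : (fun x => _) = (fun x : 'rV[R]_n => x ord0 j) \o snd); last first.
    by apply/funext => x; rewrite /= mxE liftK.
  by apply: measurableT_comp => //; exact: measurable_coord.
- rewrite (_ : (fun x => _) = fst)//.
  by apply/funext => x; rewrite /= mxE unlift_none.
Qed.

Lemma measurable_uncons_row : measurable_fun [set: 'rV[R]_n.+1] uncons_row.
Proof.
apply/measurable_fun_pairP; split; first exact: measurable_coord.
apply: measurable_fun_coordP => j.
rewrite (_ : (fun x => _) = (fun x : 'rV[R]_n.+1 => x ord0 (lift ord0 j))).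
  exact: measurable_coord.
by apply/funext => x; rewrite /= mxE.
Qed.

End cons_row.

Section lebesgue_cons.
Local Open Scope ereal_scope.
Context {R : realType} (n : nat).
Variable m : {sigma_finite_measure set 'rV[R]_n -> \bar R}.

Definition lebesgue_cons : set 'rV[R]_n.+1 -> \bar R :=
  pushforward ((@lebesgue_measure R) \x m) (@cons_row R n).

Let lebesgue_cons0 : lebesgue_cons set0 = 0.
Proof. by rewrite /lebesgue_cons /pushforward preimage_set0 measure0. Qed.

Let lebesgue_cons_ge0 A : 0 <= lebesgue_cons A.
Proof. by rewrite /lebesgue_cons /pushforward; exact: measure_ge0. Qed.

Let lebesgue_cons_sigma_additive : semi_sigma_additive lebesgue_cons.
Proof.
have mpre A : measurable A -> measurable ((@cons_row R n) @^-1` A).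
  by move=> mA; rewrite -[X in measurable X]setTI; exact: measurable_cons_row.
move=> F mF tF mUF; rewrite /lebesgue_cons /pushforward preimage_bigcup.
apply: (@measure_semi_sigma_additive _ _ _ ((@lebesgue_measure R) \x m)).
- by move=> k; exact: mpre.
- apply/trivIsetP => /= i j _ _ ij; rewrite -preimage_setI.
  by move/trivIsetP : tF => /(_ _ _ _ _ ij) ->//; rewrite preimage_set0.
- by rewrite -preimage_bigcup; exact: mpre.
Qed.

HB.instance Definition _ := isMeasure.Build _ _ _ lebesgue_cons
  lebesgue_cons0 lebesgue_cons_ge0 lebesgue_cons_sigma_additive.

Let lebesgue_cons_sigma_finite : sigma_finite setT lebesgue_cons.
Proof.
have /sigma_finiteP[F [TF ndF Foo]] := sigma_finiteT (@lebesgue_measure R).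
have /sigma_finiteP[G [TG ndG Goo]] := sigma_finiteT m.
exists (fun k => (@uncons_row R n) @^-1` (F k `*` G k)).
  rewrite -preimage_bigcup (_ : \bigcup_k _ = setT) ?preimage_setT//.
  rewrite -setXTT TF TG predeqE => -[x y]; split.
    by move=> [k _ []/= ? ?]; split; exists k.
  move=> [/= [i _ Fix] [k _ Gky]]; exists (maxn i k) => //; split.
  - by move: x Fix; exact/subsetPset/ndF/leq_maxl.
  - by move: y Gky; exact/subsetPset/ndG/leq_maxr.
move=> k; have [? ?] := Foo k; have [? ?] := Goo k.
split.
  rewrite -[X in measurable X]setTI; apply: measurable_uncons_row => //.
  exact: measurableX.
rewrite /lebesgue_cons /pushforward.
rewrite (_ : (@cons_row R n) @^-1` _ = F k `*` G k).
  by rewrite product_measure1E// lte_mul_pinfty// ge0_fin_numE.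
by apply/funext => p; rewrite -[in RHS](cons_rowK p).
Qed.

HB.instance Definition _ :=
  Measure_isSigmaFinite.Build _ _ _ lebesgue_cons lebesgue_cons_sigma_finite.

End lebesgue_cons.

Fixpoint lebesgue_rV (R : realType) (n : nat) :
    {sigma_finite_measure set 'rV[R]_n -> \bar R} :=
  match n with
  | 0 => @dirac _ 'rV[R]_0 0 R
  | n'.+1 => lebesgue_cons (lebesgue_rV R n')
  end.

Lemma lebesgue_rV_box (R : realType) (n : nat) (a b : 'rV[R]_n) :
  (forall i, a ord0 i <= b ord0 i) ->
  lebesgue_rV R n [set x | forall i, a ord0 i <= x ord0 i <= b ord0 i]
  = (\prod_(i < n) (b ord0 i - a ord0 i))%:E.
Proof.
elim: n a b => [|n IHn] a b ab.
  by rewrite big_ord0 /= diracE mem_set// => -[].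
pose t (x : 'rV[R]_n.+1) : 'rV[R]_n := \row_j x ord0 (lift ord0 j).
pose C : set 'rV[R]_n := [set x | forall i, t a ord0 i <= x ord0 i <= t b ord0 i].
pose B := (@cons_row R n) @^-1`
  [set x | forall i, a ord0 i <= x ord0 i <= b ord0 i].
rewrite -[LHS]/((@lebesgue_measure R \x lebesgue_rV R n)%E B).
have -> : B = `[a ord0 ord0, b ord0 ord0]%classic `*` C.
  rewrite predeqE => -[x y]; split => /= [h|[]].
    split; first by have := h ord0; rewrite mxE unlift_none /= in_itv.
    by move=> i; have := h (lift ord0 i); rewrite !mxE liftK.
  rewrite in_itv/= => hx hy i; rewrite mxE.
  case: (unliftP ord0 i) => [j ->|->]; last by [].
  by have := hy j; rewrite !mxE.
have mC : measurable C.
  rewrite (_ : C = \bigcap_(i in [set: 'I_n])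
      (fun x : 'rV[R]_n => x ord0 i) @^-1` `[t a ord0 i, t b ord0 i]%classic).
    apply: fin_bigcap_measurable => // i _.
    by rewrite -[X in measurable X]setTI; exact: measurable_coord.
  rewrite predeqE => x; split => [h i _|h i]; first by rewrite /= in_itv/= h.
  by have := h i I; rewrite /= in_itv.
rewrite product_measure1E//.
rewrite IHn => [|i]; last by rewrite !mxE.
rewrite big_ord_recl EFinM; congr (_ * _)%E; last first.
  by congr EFin; apply: eq_bigr => i _; rewrite !mxE.
rewrite [LHS](lebesgue_measure_itv `[a ord0 ord0, b ord0 ord0])/= lte_fin.
case: ltP => // ba; apply/esym/eqP.
by rewrite eqe subr_eq0 eq_le ba ab.
Qed.

Definition norm2 (R : realType) (d : nat) (x : 'rV[R]_d) : R :=
  Num.sqrt (\sum_(i < d) x ord0 i ^+ 2).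

Definition Gamma (R : realType) (a : R) : R :=
  \int[@lebesgue_measure R]_(t in `]0, +oo[) (t `^ (a - 1) * expR (- t)).

Definition cosh (R : realType) (t : R) : R := (expR t + expR (- t)) / 2.

(* Modified Bessel function of the second kind, by its integral representation,
   which for x > 0 is valid at every real order, integers included. *)
Definition besselK (R : realType) (nu x : R) : R :=
  \int[@lebesgue_measure R]_(t in `[0, +oo[)
    (expR (- (x * cosh t)) * cosh (nu * t)).

Definition matern (R : realType) (nu r : R) : R :=
  if r == 0 then 1
  else (Gamma nu * 2 `^ (nu - 1))^-1
       * (2 * Num.sqrt nu * r) `^ nu * besselK nu (2 * Num.sqrt nu * r).

Definition matern_kernel (R : realType) (d : nat) (nu : R)
    (x x' : 'rV[R]_d) : R :=
  matern nu (norm2 (x - x')).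

Arguments matern_kernel {R d} nu x x'.

(* A function on Omega is represented by a total function, whose values outside
   Omega are irrelevant. *)
Section functions_on_region.
Context {R : realType} {d : nat}.
Local Notation E := 'rV[R]_d.
Local Notation mu := (lebesgue_rV R d).
Implicit Types (Omega : set E) (Psi : E -> E -> R) (g : E -> R).

Definition normL2 Omega g : \bar R := Lnorm mu 2%:E (EFin \o g \_ Omega).

Definition cov_kernel Omega Psi g g' : R :=
  \int[mu]_(x' in Omega) \int[mu]_(x in Omega) (g x * g' x' * Psi x x').

(* Indices start at 0: lambda j and phi j are the (j+1)-st eigenvalue and
   eigenfunction.  The phi j are the continuous representatives, for which the
   expansion holds pointwise. *)
Record mercer_system Omega Psi (lambda : nat -> R) (phi : nat -> E -> R) :
    Prop := {
  mercer_gt0 : forall j, 0 < lambda j ;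
  mercer_nonincreasing : forall i j, (i <= j)%N -> lambda j <= lambda i ;
  mercer_continuous : forall j, {within Omega, continuous (phi j)} ;
  mercer_orthonormal : forall i j,
    \int[mu]_(x in Omega) (phi i x * phi j x) = (i == j)%:R ;
  mercer_eigen : forall j x, Omega x ->
    \int[mu]_(x' in Omega) (phi j x' * Psi x x') = lambda j * phi j x ;
  mercer_expansion : forall x x', Omega x -> Omega x' ->
    (fun m => \sum_(0 <= j < m) lambda j * phi j x * phi j x') @ \oo
      --> Psi x x' }.

End functions_on_region.

(* A real Hilbert space of functions on X with reproducing kernel k; such a
   space is unique. *)
Record rkhs (R : realType) (X : Type) (k : X -> X -> R) := Rkhs {
  rkhs_carrier : set (X -> R) ;
  rkhs_dot : (X -> R) -> (X -> R) -> R ;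
  rkhs_lin : forall a g h, rkhs_carrier g -> rkhs_carrier h ->
    rkhs_carrier (a *: g + h) ;
  rkhs_dotC : forall g h, rkhs_carrier g -> rkhs_carrier h ->
    rkhs_dot g h = rkhs_dot h g ;
  rkhs_dotDl : forall a g h u,
    rkhs_carrier g -> rkhs_carrier h -> rkhs_carrier u ->
    rkhs_dot (a *: g + h) u = a * rkhs_dot g u + rkhs_dot h u ;
  rkhs_dot_gt0 : forall g, rkhs_carrier g -> g <> 0 -> 0 < rkhs_dot g g ;
  rkhs_complete : forall u : nat -> X -> R, (forall m, rkhs_carrier (u m)) ->
    (forall e : R, 0 < e -> exists N, forall m n, (N <= m)%N -> (N <= n)%N ->
       rkhs_dot (u m - u n) (u m - u n) < e) ->
    exists2 h, rkhs_carrier h &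
      (fun m => rkhs_dot (u m - h) (u m - h)) @ \oo --> (0 : R) ;
  rkhs_kernel : forall x, rkhs_carrier (k^~ x) ;
  rkhs_reproducing : forall g x, rkhs_carrier g -> rkhs_dot g (k^~ x) = g x }.

Definition rkhs_norm (R : realType) (X : Type) (k : X -> X -> R) (H : rkhs k)
    (g : X -> R) : R :=
  Num.sqrt (rkhs_dot H g g).

Definition restr (R : realType) (d : nat) (Omega : set 'rV[R]_d)
    (g : 'rV[R]_d -> R) : Omega -> R :=
  fun x => g (val x).

Definition restr_kernel (R : realType) (d : nat) (Omega : set 'rV[R]_d)
    (Psi : 'rV[R]_d -> 'rV[R]_d -> R) : Omega -> Omega -> R :=
  fun x x' => Psi (val x) (val x').

Arguments restr {R d} Omega g.
Arguments restr_kernel {R d} Omega Psi.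

Section probability.
Local Open Scope ereal_scope.
Context {d'} {T : measurableType d'} {R : realType} (P : probability T R).

(* The library's normal_prob m 0 is a uniform law, whereas the degenerate
   Gaussian law is a point mass. *)
Definition gaussian_law (m s : R) : set R -> \bar R :=
  if s == 0%R then dirac m else normal_prob m s.

Definition gaussian_rv (X : T -> R) : Prop :=
  exists m s : R, forall A : set R, measurable A ->
    P (X @^-1` A) = gaussian_law m s A.

Definition gaussian_process (I : Type) (V : set I) (f : I -> {RV P >-> R}) :
    Prop :=
  forall (m : nat) (c : 'I_m -> R) (g : 'I_m -> I), (forall i, V (g i)) ->
    gaussian_rv (fun w => \sum_(i < m) c i * f (g i) w)%R.

Definition mean_zero_gaussian_process (I : Type) (V : set I)
    (f : I -> {RV P >-> R}) (K : I -> I -> R) : Prop :=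
  [/\ gaussian_process V f,
      forall g, V g -> 'E_P[f g] = 0 &
      forall g g', V g -> V g' -> covariance P (f g) (f g') = (K g g')%:E].

(* Z is a version of the conditional expectation of X given Y_0, ..., Y_(n-1). *)
Definition is_cond_expectation (n : nat) (X : T -> R) (Y : 'I_n -> T -> R)
    (Z : T -> R) : Prop :=
  [/\ forall B : set R, measurable B -> g_sigma_preimage Y (Z @^-1` B),
      P.-integrable setT (EFin \o Z) &
      forall A, g_sigma_preimage Y A ->
        \int[P]_(w in A) (Z w)%:E = \int[P]_(w in A) (X w)%:E].

End probability.

(* Main.v *)
Require Import Defs.
From mathcomp Require Import all_boot all_order all_algebra.
From mathcomp Require Import all_classical all_reals all_analysis.
From mathcomp Require Import measurable_realfun ring lra.

Set Implicit Arguments.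
Unset Strict Implicit.
Unset Printing Implicit Defensive.

Import Order.TTheory GRing.Theory Num.Theory.
Import numFieldNormedType.Exports.

Local Open Scope classical_set_scope.
Local Open Scope ring_scope.

(** Writing [c_j] for the [L2] coefficients of [g], the conditional expectation
    minimises the mean square error over functions of the [f (phi_j)], so
    the error is at most that of the predictor [sum_(j < n) c_j f (phi_j)],
    which Mercer's expansion evaluates to [sum_(j >= n) lambda_j c_j^2].  By
    Bessel's inequality this is at most [lambda_n |g|_L2^2], and, since
    [sum_j c_j^2 / lambda_j <= |g|_N^2], also at most [lambda_n^2 |g|_N^2].

    It remains to see that [lambda_n = O(n^(-2 nu / d))].  The Matern function
    is a mixture of Gaussians,
      [matern nu r = Gamma(nu)^-1 int_0^oo s^(nu-1) e^(-s) e^(-nu r^2/s) ds].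
    On a cube of side [h], the part [s <= h^2] is [O(h^(2 nu))], and for
    [s > h^2] the Gaussian is replaced by its Taylor polynomial in
    [|y - x|^2 - |y - c|^2], where [c] is a vertex of the cube, with error
    [O((h^2/s)^q)] for an integer [q > nu]; the integral of these errors is
    again [O(h^(2 nu))].  A grid of [N^d] cubes thus gives a kernel of rank
    [O(N^d)] at uniform distance [O(N^(-2 nu))] from the Matern kernel, and a
    combination of [phi_0, ..., phi_n] orthogonal to this kernel bounds
    [lambda_n].

    The bound on [sum_j c_j^2 / lambda_j] is the Cauchy-Schwarz inequality in
    the native space between [g] and Riemann sums for
    [sum_(j < m) (c_j / lambda_j) int_Omega phi_j(x) Psi(., x) dx]. *)

(** * The gamma mixture *)

(** The split at s = h^2 is where the Gaussian, of width of order sqrt s, becomes wider than the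
    cube: narrower ones are not smooth on the cube but carry little mass, and for wider ones the
    remainder s^(nu-1) (h^2/s)^q is integrable at infinity because q > nu. As the expansion is
    around a vertex of the cube of x, the increment v is of size |y - c| h rather than h^2. The
    factor e^(-nu |y - c|^2 / s) absorbs the growth in |y - c|, each power of v then counts as one
    power of h / sqrt s, and so 2q terms are taken.

    Two weak assumptions shape the other half. A version of the conditional expectation is only
    known to be integrable, so its orthogonality is tested against bounded functions, on sets where
    it is bounded. The native space is known only through its axioms: finite combinations of kernel
    sections belong to it, whereas membership of their integrals would have to be proved. Riemann
    sums avoid this, and their error is sent to 0 in the resulting inequality between numbers. *)

Section power_integrals.
Context {R : realType}.
Local Notation leb := (@lebesgue_measure R).

Lemma continuous_powR_pos (p x : R) : 0 < x -> {for x, continuous (fun s : R =>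
  s `^ p)}.
Proof.
move=> x0; apply: differentiable_continuous; apply/derivable1_diffP.
by apply: derivable_powR; rewrite in_itv/= x0.
Qed.

Lemma integral_powR_itv (p a b : R) : 0 < a -> a <= b -> p + 1 != 0 ->
  (\int[leb]_(s in `[a, b]) (s `^ p)%:E
   = ((b `^ (p + 1) - a `^ (p + 1)) / (p + 1))%:E)%E.
Proof.
move=> a0; rewrite le_eqVlt => /orP[/eqP <- _|ab p1].
  by rewrite set_itv1 integral_set1 subrr mul0r.
have b0 : 0 < b by exact: lt_trans ab.
pose F : R -> R := fun s => s `^ (p + 1) * (p + 1)^-1.
have dF (x : R) : 0 < x -> is_derive x 1 F (x `^ p).
  move=> x0.
  have dp : is_derive x 1 (fun s : R => s `^ (p + 1)) ((p + 1) * x `^ p).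
    apply: DeriveDef; first by apply: derivable_powR; rewrite in_itv/= x0.
    by rewrite -derive1E powR_derive1 ?in_itv/= ?x0// addrK.
  have -> : F = (p + 1)^-1 \*: (fun s : R => s `^ (p + 1)).
    by apply/funext => s; rewrite /F /= mulrC.
  have -> : x `^ p = (p + 1)^-1 *: ((p + 1) * x `^ p).
    by rewrite /GRing.scale/= mulrA mulVf// mul1r.
  exact: is_deriveZ.
rewrite (@continuous_FTC2 _ (fun s : R => s `^ p) F a b)//.
- by rewrite /F -EFinB -mulrBl.
- apply: continuous_in_subspaceT => x; rewrite inE/= in_itv/= => /andP[ax _].
  by apply: continuous_powR_pos; exact: lt_le_trans ax.
- have cF (x : R) : 0 < x -> {for x, continuous F}.
    move=> x0; apply: differentiable_continuous; apply/derivable1_diffP.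
    by have [] := dF _ x0.
  split.
  + move=> x; rewrite in_itv/= => /andP[ax _].
    by have [] := dF x (lt_trans a0 ax).
  + by apply: cvg_at_right_filter; exact: cF.
  + by apply: cvg_at_left_filter; exact: cF.
- move=> x; rewrite in_itv/= => /andP[ax _].
  by rewrite derive1E; apply: derive_val; exact: dF (lt_trans a0 ax).
Qed.

(** Monotone convergence, in the form that carries the values of [integral_powR_itv] over to
    intervals with an open end at 0 or an infinite end. *)
Lemma le_integral_nondecreasing (f : R -> R) (F : (set R)^nat)
    (D : set R) (M : \bar R) :
  (forall i, measurable (F i)) -> {homo F : m n / (m <= n)%N >-> m `<=` n} ->
  measurable_fun [set: R] f -> (forall x, D x -> 0 <= f x) ->
  D = \bigcup_i F i ->
  (forall i, \int[leb]_(x in F i) (f x)%:E <= M)%E ->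
  (\int[leb]_(x in D) (f x)%:E <= M)%E.
Proof.
move=> mF ndF mf f0 DE FM.
have cv : (\int[leb]_(x in F i) (f x)%:E)%E @[i --> \oo] -->
    (\int[leb]_(x in D) (f x)%:E)%E.
  rewrite DE; apply: (@ge0_nondecreasing_set_cvg_integral _ (measurableTypeR R)
      R F (EFin \o f) lebesgue_measure) => //.
  - by move=> m n mn; apply/subsetPset; exact: ndF.
  - by move=> i; apply/measurable_EFinP; exact: measurable_funTS.
  - by move=> i x Fx; rewrite lee_fin; apply: f0; rewrite DE; exists i.
rewrite -(cvg_lim _ cv)//; apply: lime_le => //.
  by apply/cvg_ex; exists (\int[leb]_(x in D) (f x)%:E)%E.
by near=> n; exact: FM.
Unshelve. all: by end_near. Qed.

Lemma integral_powR_near0 (p h : R) : 0 < p -> 0 < h ->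
  (\int[leb]_(s in `]0%R, h]) (s `^ (p - 1))%:E <= (h `^ p / p)%:E)%E.
Proof.
move=> p0 h0.
apply: (@le_integral_nondecreasing _ (fun n => `[h / n.+1%:R, h]%classic)).
- by [].
- move=> m n mn x /=; rewrite !in_itv/= => /andP[hx ->]; rewrite andbT.
  apply: le_trans hx; rewrite ler_pM2l// lef_pV2 ?posrE ?ltr0n//.
  by rewrite ler_nat.
- exact: measurable_powR.
- by move=> x _; rewrite powR_ge0.
- rewrite predeqE => x; split => /=; last first.
    move=> [n _] /=; rewrite !in_itv/= => /andP[hx ->]; rewrite andbT.
    by apply: lt_le_trans hx; rewrite divr_gt0.
  rewrite in_itv/= => /andP[x0 xh].
  exists (Num.truncn (h / x)) => //=; rewrite in_itv/= xh andbT.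
  rewrite ler_pdivrMr// mulrC -ler_pdivrMr//.
  by apply: ltW; apply: truncnS_gt.
- move=> n; rewrite integral_powR_itv; first last.
  + by rewrite subrK gt_eqF.
  + by rewrite ler_pdivrMr// ler_peMr ?ler1n// ltW.
  + by rewrite divr_gt0.
  rewrite subrK lee_fin ler_pM2r ?invr_gt0// lerBlDr lerDl.
  exact: powR_ge0.
Qed.

Lemma integral_powR_infty (p h : R) : 0 < p -> 0 < h ->
  (\int[leb]_(s in `]h, +oo[) (s `^ (- p - 1))%:E <= (h `^ (- p) / p)%:E)%E.
Proof.
move=> p0 h0.
apply: (@le_trans _ _ (\int[leb]_(s in `[h, +oo[) (s `^ (- p - 1))%:E)%E).
  apply: ge0_subset_integral => //.
  - apply/measurable_EFinP; apply: measurable_funTS; exact: measurable_powR.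
  - by move=> x _; rewrite lee_fin powR_ge0.
  - by move=> x /=; rewrite !in_itv/= => /andP[/ltW -> _].
apply: (@le_integral_nondecreasing _ (fun n => `[h, h + n%:R]%classic)).
- by [].
- move=> m n mn x /=; rewrite !in_itv/= => /andP[-> hx] /=.
  by apply: le_trans hx _; rewrite lerD2l ler_nat.
- exact: measurable_powR.
- by move=> x _; rewrite powR_ge0.
- rewrite predeqE => x; split => /=; last first.
    by move=> [n _] /=; rewrite !in_itv/= => /andP[->].
  rewrite in_itv/= andbT => hx.
  exists (Num.truncn (x - h)).+1 => //=; rewrite in_itv/= hx/=.
  by rewrite -lerBlDl; apply: ltW; apply: truncnS_gt.
- move=> n; rewrite integral_powR_itv//; first last.
  + by rewrite subrK oppr_eq0 gt_eqF.
  + by rewrite lerDl.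
  rewrite subrK lee_fin invrN mulrN -mulNr ler_pM2r ?invr_gt0//.
  by rewrite opprB lerBlDr lerDl powR_ge0.
Qed.

End power_integrals.

Section gamma_mixture.
Context {R : realType}.
Local Notation leb := (@lebesgue_measure R).
Implicit Types (nu x s t A : R).

(** The integrand of [Gamma], left unnormalised; [matern_mixture] divides by its total mass. *)
Definition gamma_weight nu s : R := s `^ (nu - 1) * expR (- s).

Lemma gamma_weight_ge0 nu s : 0 <= gamma_weight nu s.
Proof. by rewrite mulr_ge0// ?powR_ge0// expR_ge0. Qed.

Lemma measurable_gamma_weight nu : measurable_fun [set: R] (gamma_weight nu).
Proof.
apply: measurable_funM; first exact: measurable_powR.
by apply: measurableT_comp => //; apply: measurable_funN.
Qed.

Lemma le_gamma_weight nu s : 0 < s -> gamma_weight nu s <= s `^ (nu - 1).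
Proof.
move=> s0; rewrite ler_piMr ?powR_ge0// -expR0 ler_expR oppr_le0 ltW//.
Qed.

Lemma integral_gamma_weight_near0 nu h : 0 < nu -> 0 < h ->
  (\int[leb]_(s in `]0%R, h]) (gamma_weight nu s)%:E <= (h `^ nu / nu)%:E)%E.
Proof.
move=> nu0 h0; apply: le_trans (integral_powR_near0 nu0 h0).
apply: ge0_le_integral => //=.
- by move=> s _; rewrite lee_fin gamma_weight_ge0.
- apply/measurable_EFinP; apply: measurable_funTS.
  exact: measurable_gamma_weight.
- apply/measurable_EFinP; apply: measurable_funTS; exact: measurable_powR.
- by move=> s; rewrite in_itv/= => /andP[s0 _]; rewrite lee_fin le_gamma_weight.
Qed.

Lemma integrable_gamma_weight nu : 0 < nu ->
  leb.-integrable `]0, +oo[ (EFin \o gamma_weight nu).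
Proof.
move=> nu0; apply/integrableP; split.
  apply/measurable_EFinP; apply: measurable_funTS.
  exact: measurable_gamma_weight.
under eq_integral => s _.
  rewrite /= ger0_norm ?gamma_weight_ge0//.
  over.
have -> : `]0%R, +oo[%classic = `]0%R, 1%R] `|` `]1%R, +oo[%classic :> set R.
  rewrite predeqE => s /=; rewrite !in_itv/= !andbT; split.
    by move=> ->; case: (leP s 1) => _; [left|right].
  by move=> [/andP[]//|]; exact: lt_trans.
rewrite ge0_integral_setU//=; first last.
- rewrite disj_set2E; apply/eqP; rewrite predeqE => s; split => //= -[].
  by rewrite !in_itv/= andbT => /andP[_ s1] /(le_lt_trans s1); rewrite ltxx.
- by move=> s _; rewrite lee_fin gamma_weight_ge0.
- apply/measurable_EFinP; apply: measurable_funTS.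
  exact: measurable_gamma_weight.
rewrite lte_add_pinfty//.
  by apply: le_lt_trans (integral_gamma_weight_near0 nu0 ltr01) _; rewrite ltry.
(* As nu - 1 < m and s^(m+2) <= (m+2)! e^s, the weight is at most (m+2)! s^(-2) for s > 1. *)
pose m := Num.truncn nu.
pose C : R := m.+2`!%:R.
apply: (@le_lt_trans _ _
    (\int[leb]_(s in `]1%R, +oo[) (C * s `^ (- 1 - 1))%:E)%E).
  apply: ge0_le_integral => //=.
  - by move=> s _; rewrite lee_fin gamma_weight_ge0.
  - apply/measurable_EFinP; apply: measurable_funTS.
    exact: measurable_gamma_weight.
  - apply/measurable_EFinP; apply: measurable_funTS.
    by apply: measurable_funM => //; exact: measurable_powR.
  - move=> s; rewrite in_itv/= andbT => s1; rewrite lee_fin.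
    have s0 : 0 < s by exact: lt_trans s1.
    rewrite /gamma_weight expRN.
    have es : s ^+ m.+2 <= C * expR s.
      rewrite mulrC -ler_pdivrMr ?ltr0n ?fact_gt0//.
      by apply: le_trans (expR_ge1Dxn m.+1 (ltW s0)); rewrite lerDr.
    rewrite ler_pdivrMr ?expR_gt0// -mulrA mulrCA.
    apply: (@le_trans _ _ (s `^ (-1 - 1) * s ^+ m.+2)); last first.
      by rewrite ler_pM2l// powR_gt0.
    rewrite -powR_mulrn ?(ltW s0)// -powRD; last by rewrite (gt_eqF s0) implybT.
    apply: ler_powR; first exact: ltW.
    have := truncnS_gt nu; rewrite -/m => /ltW; rewrite -[m.+2]addn1 natrD; lra.
under eq_integral do rewrite EFinM.
rewrite ge0_integralZl_EFin//=; last 2 first.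
- by move=> s _; rewrite lee_fin powR_ge0.
- apply/measurable_EFinP; apply: measurable_funTS; exact: measurable_powR.
rewrite lte_mul_pinfty ?lee_fin ?ler0n//.
apply: le_lt_trans (integral_powR_infty ltr01 ltr01) _; exact: ltry.
Qed.

Lemma integrable_gamma_weightM nu (D : set R) (b : R -> R) (M : R) : 0 < nu ->
  measurable D -> D `<=` `]0, +oo[%classic -> measurable_fun [set: R] b ->
  (forall s, D s -> `|b s| <= M) ->
  leb.-integrable D (EFin \o (fun s => gamma_weight nu s * b s)).
Proof.
move=> nu0 mD D0 mb bM.
have iD : leb.-integrable D (EFin \o gamma_weight nu).
  by apply: integrableS (integrable_gamma_weight nu0).
apply: (@le_integrable _ _ _ leb D mD _
   (fun s => M%:E * (EFin \o gamma_weight nu) s)%E).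
- apply/measurable_EFinP; apply: measurable_funTS; apply: measurable_funM => //.
  exact: measurable_gamma_weight.
- move=> s Ds; rewrite /= lee_fin !normrM mulrC; apply: ler_wpM2r => //.
  exact: le_trans (bM _ Ds) (ler_norm _).
- exact: integrableZl.
Qed.

Lemma Gamma_gt0 nu : 0 < nu -> 0 < Gamma nu.
Proof.
move=> nu0; rewrite /Gamma.
(* A lower bound of the weight on [1, 2], where s^nu >= 1, 1/s >= 1/2 and e^(-s) >= e^(-2). *)
pose c : R := 2^-1 * expR (- 2).
have c0 : 0 < c by rewrite mulr_gt0// expR_gt0.
apply: (@lt_le_trans _ _ (\int[leb]_(s in `[1, 2]) c)%R).
  rewrite Rintegral_cst//= lebesgue_measure_itv/= lte_fin ltr1n.
  by rewrite -EFinD/= (_ : 2 - 1 = 1 :> R) ?mulr1//; lra.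
apply: (@le_trans _ _ (\int[leb]_(s in `[1, 2]) gamma_weight nu s)%R).
  apply: le_Rintegral => //.
  - apply: measurable_bounded_integrable => //.
    + by rewrite /= lebesgue_measure_itv/= lte_fin ltr1n -EFinD ltry.
    + by exists c; split; [exact: num_real|move=> x cx t _;
        rewrite /= ger0_norm ltW].
  - apply: integrableS (integrable_gamma_weight nu0) => // s /=.
    by rewrite !in_itv/= andbT => /andP[s1 _]; apply: lt_le_trans s1.
  - move=> s; rewrite /= in_itv/= => /andP[s1 s2].
    have s0 : 0 < s by exact: lt_le_trans s1.
    apply: ler_pM; rewrite ?expR_ge0 ?invr_ge0//;
      last by rewrite ler_expR lerN2.
    rewrite powRB; last by rewrite (gt_eqF s0) implybT.
    rewrite powRr1 ?(ltW s0)//.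
    apply: (@le_trans _ _ s^-1); first by rewrite lef_pV2 ?posrE.
    rewrite ler_peMl ?invr_ge0 ?(ltW s0)//.
    by rewrite -[leLHS](powRr0 s) ler_powR// ltW.
apply: fine_le.
- apply: integrable_fin_num => //.
  apply: integrableS (integrable_gamma_weight nu0) => // s /=.
  by rewrite !in_itv/= andbT => /andP[s1 _]; apply: lt_le_trans s1.
- exact: integrable_fin_num (integrable_gamma_weight nu0).
apply: ge0_subset_integral => //=.
- apply/measurable_EFinP; apply: measurable_funTS.
  exact: measurable_gamma_weight.
- by move=> s _; rewrite lee_fin gamma_weight_ge0.
- move=> s /=.
  by rewrite !in_itv/= andbT => /andP[s1 _]; apply: lt_le_trans s1.
Qed.

End gamma_mixture.

(** * The Matern function as a mixture of Gaussians *)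

Section matern_mixture.
Context {R : realType}.
Local Notation leb := (@lebesgue_measure R).
Implicit Types (nu x s t A : R).

Lemma measurable_invr : measurable_fun [set: R] (@GRing.inv R).
Proof.
(* [powR] with exponent -1 is the inverse on nonnegative numbers, hence the square; at 0 both sides
   are 0. *)
have -> : @GRing.inv R = (fun s => s * (s ^+ 2) `^ (-1)).
  apply/funext => s; rewrite powR_inv1 ?sqr_ge0//.
  have [->|s0] := eqVneq s 0; first by rewrite invr0 mul0r.
  by rewrite expr2 invfM mulrA divff// mul1r.
apply: measurable_funM => //.
apply: (measurableT_comp (measurable_powR (-1))).
exact: measurable_funX.
Qed.

Definition gamma_mixture nu A : R :=
  \int[leb]_(s in `]0, +oo[) (gamma_weight nu s * expR (- (A / s))).

(** [G] is the mixture integrand at A = (x/2)^2, and [H] is what the substitution s = (x/2) e^t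
    makes of it, Jacobian included. The scale x/2 balances the two exponents: s + (x/2)^2 / s = x
    cosh t. *)
Let G nu x s : R := gamma_weight nu s * expR (- ((x / 2) ^+ 2 / s)).

Let H nu x t : R := (x / 2) `^ nu * (expR (nu * t) * expR (- (x * cosh t))).

Let G_ge0 nu x s : 0 <= G nu x s.
Proof. by rewrite mulr_ge0// ?expR_ge0// gamma_weight_ge0. Qed.

Let H_ge0 nu x t : 0 <= H nu x t.
Proof. by rewrite mulr_ge0 ?powR_ge0// mulr_ge0 ?expR_ge0. Qed.

Let measurable_G nu x : measurable_fun [set: R] (G nu x).
Proof.
apply: measurable_funM; first exact: measurable_gamma_weight.
apply: measurableT_comp => //; apply: measurable_funN.
by apply: measurable_funM => //; exact: measurable_invr.
Qed.

Let continuous_cosh : continuous (@cosh R).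
Proof.
move=> t; apply: cvgMl; apply: cvgD; first exact: continuous_expR.
apply: continuous_comp; [exact: continuousN|exact: continuous_expR].
Qed.

Let continuous_H nu x : continuous (H nu x).
Proof.
move=> t; apply: cvgM; first exact: cvg_cst.
apply: cvgM; (apply: continuous_comp; last exact: continuous_expR).
  by apply: cvgM; [exact: cvg_cst|exact: cvg_id].
apply: cvgN; apply: cvgM; [exact: cvg_cst|exact: continuous_cosh].
Qed.

Let measurable_H nu x : measurable_fun [set: R] (H nu x).
Proof. by apply: continuous_measurable_fun; exact: continuous_H. Qed.

Let substitution_itv nu x (n : nat) : 0 < nu -> 0 < x ->
  (\int[leb]_(s in `[(x / 2 * expR (- n%:R))%R, (x / 2 * expR n%:R)%R]) (G nu x
    s)%:E
   = \int[leb]_(t in `[(- n%:R)%R, n%:R]) (H nu x t)%:E)%E.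
Proof.
move=> nu0 x0; have x20 : 0 < x / 2 by rewrite divr_gt0.
pose F t := x / 2 * expR t.
have F0 t : 0 < F t by rewrite mulr_gt0// expR_gt0.
have dF t : is_derive t 1 F (F t).
  have -> : F = (x / 2) \*: expR by apply/funext => u.
  by apply: is_deriveZ; exact: is_derive_expR.
have cF : continuous F.
  move=> t; apply: differentiable_continuous; apply/derivable1_diffP.
  by have [] := dF t.
have F'E : F^`()%classic = F.
  by apply/funext => t; rewrite derive1E; apply: derive_val.
rewrite (@integration_by_substitution_increasing _ F)//; first last.
- apply: continuous_in_subspaceT => s; rewrite inE/= in_itv/= => /andP[Fs _].
  have s0 : 0 < s by exact: lt_le_trans Fs.
  apply: cvgM.
    apply: cvgM; first exact: continuous_powR_pos.
    apply: continuous_comp; [exact: continuousN|exact: continuous_expR].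
  apply: continuous_comp; last exact: continuous_expR.
  apply: cvgN; apply: cvgM; first exact: cvg_cst.
  by apply: cvgV; [rewrite gt_eqF|exact: cvg_id].
- split.
  + by move=> t _; have [] := dF t.
  + by apply: cvg_at_right_filter; exact: cF.
  + by apply: cvg_at_left_filter; exact: cF.
- rewrite F'E; apply/cvg_ex; exists (F n%:R).
  by apply: cvg_at_left_filter; exact: cF.
- rewrite F'E; apply/cvg_ex; exists (F (- n%:R)).
  by apply: cvg_at_right_filter; exact: cF.
- by rewrite F'E => t _; exact: cF.
- by move=> s t _ _ st; rewrite ltr_pM2l// ltr_expR.
- by rewrite ge0_cp.
apply: eq_integral => t _; congr EFin; rewrite F'E.
rewrite -[LHS]/(G nu x (F t) * F t) /G /H /gamma_weight.
have Et := expR_gt0 t.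
have -> : (x / 2) ^+ 2 / F t = x / 2 * expR (- t).
  by rewrite /F expRN; field; rewrite gt_eqF//= gt_eqF.
rewrite mulrC !mulrA mulr_powRB1 ?(ltW (F0 t))//.
rewrite {1}/F powRM ?(ltW Et) ?(ltW x20)// -expRM [t * nu]mulrC -!mulrA.
congr (_ * (_ * _)); rewrite -expRD; congr expR.
by rewrite /F /cosh; field.
Qed.

Let mixture_integralT nu x : 0 < nu -> 0 < x ->
  (\int[leb]_(s in `]0%R, +oo[) (G nu x s)%:E = \int[leb]_t (H nu x t)%:E)%E.
Proof.
move=> nu0 x0; have x20 : 0 < x / 2 by rewrite divr_gt0.
pose D (n : nat) := `[x / 2 * expR (- n%:R), x / 2 * expR n%:R]%classic.
have cvG : (\int[leb]_(s in D n) (G nu x s)%:E)%E @[n --> \oo] -->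
    (\int[leb]_(s in `]0%R, +oo[) (G nu x s)%:E)%E.
  have -> : `]0%R, +oo[%classic = \bigcup_n D n.
    rewrite predeqE => s; split => /=; last first.
      move=> [n _]; rewrite /D/= !in_itv/= andbT => /andP[+ _].
      by apply: lt_le_trans; rewrite mulr_gt0// expR_gt0.
    rewrite in_itv/= andbT => s0.
    pose q := s / (x / 2); have q0 : 0 < q by rewrite divr_gt0.
    exists (Num.truncn `|ln q|).+1 => //; rewrite /D/= in_itv/=.
    have -> : s = x / 2 * expR (ln q).
      by rewrite lnK ?posrE// mulrC divfK// gt_eqF.
    rewrite !ler_pM2l// !ler_expR -ler_norml.
    by apply: ltW; exact: truncnS_gt.
  apply: (@ge0_nondecreasing_set_cvg_integral _ (measurableTypeR R) R D
      (EFin \o G nu x) lebesgue_measure) => //.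
  - move=> m n mn; apply/subsetPset => s; rewrite /D/= !in_itv/=.
    move=> /andP[h1 h2]; apply/andP; split.
      by apply: le_trans h1; rewrite ler_pM2l// ler_expR lerN2 ler_nat.
    by apply: le_trans h2 _; rewrite ler_pM2l// ler_expR ler_nat.
  - by move=> i; exact: measurable_itv.
  - by move=> i; apply/measurable_EFinP; apply: measurable_funTS;
      exact: measurable_G.
  - by move=> i s _; rewrite lee_fin.
have cvH : (\int[leb]_(t in `[(- n%:R)%R, n%:R]) (H nu x t)%:E)%E @[n --> \oo]
  -->
    (\int[leb]_t (H nu x t)%:E)%E.
  have -> : [set: R] = \bigcup_n `[- n%:R, n%:R]%classic.
    rewrite predeqE => s; split => //= _.
    exists (Num.truncn `|s|).+1 => //; rewrite /= in_itv/= -ler_norml.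
    by apply: ltW; exact: truncnS_gt.
  apply: (@ge0_nondecreasing_set_cvg_integral _ (measurableTypeR R) R
      (fun n : nat => `[- n%:R, n%:R]%classic)
      (EFin \o H nu x) lebesgue_measure) => //.
  - move=> m n mn; apply/subsetPset => s; rewrite /= !in_itv/=.
    move=> /andP[h1 h2]; apply/andP; split.
      by apply: le_trans h1; rewrite lerN2 ler_nat.
    by apply: le_trans h2 _; rewrite ler_nat.
  - by move=> i; apply/measurable_EFinP; apply: measurable_funTS;
      exact: measurable_H.
  - by move=> i s _; rewrite lee_fin.
rewrite -(cvg_lim _ cvG)// -(cvg_lim _ cvH)//; congr (lim (_ @ \oo)).
by apply/funext => n; exact: substitution_itv.
Qed.

(** Folding the negative half-line onto the positive one turns e^(nu t) into 2 cosh(nu t), as cosh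
    is even; up to a constant this is the integrand of [besselK]. *)
Let integral_H nu x :
  (\int[leb]_t (H nu x t)%:E
   = \int[leb]_(t in `[0%R, +oo[)
       (2 * (x / 2) `^ nu * (expR (- (x * cosh t)) * cosh (nu * t)))%R%:E)%E.
Proof.
rewrite -{1}setC0 -(set_itvoc0 0%R) setCitv/= ge0_integral_setU//=; first last.
- rewrite disj_set2E; apply/eqP; rewrite -subset0 => t []/= /[!in_itv]/=.
  by rewrite leNgt andbT => /negP.
- by move=> t _; rewrite lee_fin.
- by apply/measurable_EFinP; apply: measurable_funTS; exact: measurable_H.
rewrite integral_itv_obnd_cbnd; last first.
  by apply/measurable_EFinP; apply: measurable_funTS; exact: measurable_H.
rewrite -{1}[0%R]oppr0 ge0_integration_by_substitutionNy//; last first.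
  by apply: continuous_subspaceT; exact: continuous_H.
rewrite -ge0_integralD//=; last 4 first.
- by move=> t _; rewrite lee_fin.
- apply/measurable_EFinP; apply: measurable_funTS.
  by apply: measurableT_comp => //; exact: measurable_funN.
- by move=> t _; rewrite lee_fin.
- by apply/measurable_EFinP; apply: measurable_funTS; exact: measurable_H.
apply: eq_integral => t _; rewrite -EFinD; congr EFin.
rewrite /H /cosh opprK mulrN [expR (- t) + _]addrC.
by field.
Qed.

Lemma matern_mixture nu r : 0 < nu -> 0 <= r ->
  matern nu r = (Gamma nu)^-1 * gamma_mixture nu (nu * r ^+ 2).
Proof.
move=> nu0; have G0 := Gamma_gt0 nu0.
rewrite /matern le_eqVlt => /orP[/eqP <-|r0].
  (* The prescribed value 1 at r = 0 agrees with the mixture, which is Gamma(nu) / Gamma(nu)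
     there. *)
  rewrite eqxx expr0n mulr0 /gamma_mixture.
  under eq_Rintegral do rewrite mul0r oppr0 expR0 mulr1.
  by rewrite mulVf// gt_eqF.
rewrite gt_eqF//; set x := 2 * Num.sqrt nu * r.
rewrite invfM -!mulrA; congr (_ * _).
have x0 : 0 < x by rewrite !mulr_gt0// sqrtr_gt0.
have x20 : 0 < x / 2 by rewrite divr_gt0.
have -> : nu * r ^+ 2 = (x / 2) ^+ 2.
  by rewrite /x -{1}(sqr_sqrtr (ltW nu0)); field.
have c0 : 0 < 2 * (x / 2) `^ nu :> R by rewrite mulr_gt0// powR_gt0.
rewrite /gamma_mixture /Rintegral mixture_integralT// integral_H.
under [in RHS]eq_integral do rewrite EFinM.
rewrite ge0_integralZl_EFin//; last 3 first.
- move=> t _; rewrite lee_fin mulr_ge0 ?expR_ge0//.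
  by rewrite divr_ge0// addr_ge0 ?expR_ge0.
- apply/measurable_EFinP; apply: measurable_funTS.
  apply: continuous_measurable_fun => t; apply: cvgM.
    apply: continuous_comp; last exact: continuous_expR.
    by apply: cvgN; apply: cvgM; [exact: cvg_cst|exact: continuous_cosh].
  apply: continuous_comp; last exact: continuous_cosh.
  by apply: cvgM; [exact: cvg_cst|exact: cvg_id].
- exact: ltW.
rewrite /besselK /Rintegral.
set I := (\int[leb]_(t in `[0%R, +oo[) _)%E.
have I0 : (0 <= I)%E.
  apply: integral_ge0 => t _; rewrite lee_fin mulr_ge0 ?expR_ge0//.
  by rewrite divr_ge0// addr_ge0 ?expR_ge0.
(* [fine] sends +oo to 0, so both sides would vanish if [I] were infinite. *)
have -> : fine ((2 * (x / 2) `^ nu)%:E * I)%E = 2 * (x / 2) `^ nu * fine I.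
  move: I0; case: I => [I| |] //= _.
  by rewrite gt0_muley ?lte_fin//= mulr0.
rewrite mulrA; congr (_ * _).
clearbody x.
have e2 : 2^-1 `^ nu = (2 `^ nu)^-1 :> R.
  by rewrite -powR_inv1// -powRrM mulN1r powRN.
rewrite powRM ?(ltW x0) ?invr_ge0// e2 powRB ?pnatr_eq0 ?implybT// powRr1//.
by field; rewrite gt_eqF// powR_gt0.
Qed.

End matern_mixture.

(** * Local polynomial approximation *)

Section exp_remainder.
Context {R : realType}.
Implicit Types (t s z v h nu b w B : R) (k m : nat).

(** Taking t^k out of the tail of the series and using (m + k)! >= m! leaves the exponential series
    of |t|. *)
Lemma expR_taylor_remainder k t :
  `|expR t - \sum_(m < k) t ^+ m / m`!%:R| <= `|t| ^+ k * expR `|t|.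
Proof.
have cv : (\sum_(0 <= m < N) exp_coeff t m) @[N --> \oo] --> expR t.
  exact: is_cvg_series_exp_coeff.
have cvB : (`|\sum_(0 <= m < N) exp_coeff t m - \sum_(m < k) t ^+ m / m`!%:R|)
    @[N --> \oo] --> `|expR t - \sum_(m < k) t ^+ m / m`!%:R|.
  by apply: cvg_norm; apply: cvgB => //; exact: cvg_cst.
rewrite -(cvg_lim _ cvB)//; apply: limr_le; first by apply/cvg_ex; eexists;
  exact: cvB.
near=> N.
have kN : (k <= N)%N by near: N; exists k.
have -> : \sum_(0 <= m < N) exp_coeff t m - \sum_(m < k) t ^+ m / m`!%:R =
    \sum_(k <= m < N) exp_coeff t m.
  by rewrite (big_cat_nat (leq0n k) kN)/= big_mkord addrAC subrr add0r.
apply: le_trans (ler_norm_sum _ _ _) _.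
have le_exp (n : nat) : \sum_(0 <= m < n) exp_coeff `|t| m <= expR `|t|.
  apply: (@nondecreasing_cvgn_le _ (series (exp_coeff `|t|))).
    by apply: nondecreasing_series => m _ _; exact: exp_coeff_ge0.
  exact: is_cvg_series_exp_coeff.
apply: (@le_trans _ _ (`|t| ^+ k * \sum_(0 <= m < N - k) exp_coeff `|t| m)).
  rewrite -{1}[k]add0n big_addn mulr_sumr.
  apply: ler_sum => m _; rewrite /exp_coeff /= normrM normrX normfV normr_nat.
  rewrite mulrA -exprD addnC; apply: ler_wpM2l; first exact: exprn_ge0.
  rewrite lef_pV2 ?posrE ?ltr0n ?fact_gt0// ler_nat.
  by apply: leq_fact; rewrite ?leq_addr ?leq_addl.
by apply: ler_wpM2l; rewrite ?exprn_ge0.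
Unshelve. all: by end_near. Qed.

Lemma exprn_le_fact_expR k t : 0 <= t -> t ^+ k <= k`!%:R * expR t.
Proof.
move=> t0; case: k => [|k]; first by rewrite expr0 mul1r -expR0 ler_expR.
rewrite mulrC -ler_pdivrMr ?ltr0n ?fact_gt0//.
by apply: le_trans (expR_ge1Dxn k t0); rewrite lerDr.
Qed.

(** e^(-w^2) absorbs all that grows with w: (2w + B)^k <= k! e^(2w + B), and the exponents then add
    up to (1 + B)^2 + B + B^2 - (w - (1 + B))^2. The bound is thus uniform in w, which will be the
    scaled distance from y to a vertex. *)
Lemma gauss_taylor_remainder k B w b t :
  0 <= w -> 0 <= b <= B -> `|t| <= 2 * w * b + b ^+ 2 ->
  expR (- w ^+ 2) * `|expR t - \sum_(m < k) t ^+ m / m`!%:R|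
  <= k`!%:R * expR ((1 + B) ^+ 2 + B + B ^+ 2) * b ^+ k.
Proof.
move=> w0 /andP[b0 bB] tb.
have B0 : 0 <= B by exact: le_trans bB.
have wb : w * b <= w * B by exact: ler_wpM2l.
have b2 : b ^+ 2 <= B ^+ 2 by rewrite lerXn2r ?nnegrE.
apply: (@le_trans _ _ (expR (- w ^+ 2) *
    ((b * (2 * w + B)) ^+ k * expR (2 * w * B + B ^+ 2)))).
  apply: ler_wpM2l; first exact: expR_ge0.
  apply: le_trans (expR_taylor_remainder k t) _.
  apply: ler_pM; rewrite ?exprn_ge0 ?expR_ge0//.
    rewrite lerXn2r ?nnegrE ?mulr_ge0 ?addr_ge0 ?mulr_ge0//.
    by apply: le_trans tb _; rewrite mulrDr; nra.
  by rewrite ler_expR; apply: le_trans tb _; nra.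
have X0 : 0 <= 2 * w + B by nra.
rewrite exprMn.
have -> : expR (- w ^+ 2) * (b ^+ k * (2 * w + B) ^+ k * expR (2 * w * B + B ^+
  2))
    = b ^+ k * ((2 * w + B) ^+ k * expR (- w ^+ 2 + (2 * w * B + B ^+ 2))).
  by rewrite (expRD (- w ^+ 2)); ring.
rewrite [leRHS]mulrC; apply: ler_wpM2l; first exact: exprn_ge0.
apply: (@le_trans _ _ ((k`!%:R * expR (2 * w + B)) *
    expR (- w ^+ 2 + (2 * w * B + B ^+ 2)))).
  by apply: ler_wpM2r; rewrite ?expR_ge0// exprn_le_fact_expR.
rewrite -mulrA -expRD; apply: ler_wpM2l; first exact: ler0n.
rewrite ler_expR; have := sqr_ge0 (w - (1 + B)); nra.
Qed.

End exp_remainder.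

Section matern_local.
Context {R : realType}.
Local Notation leb := (@lebesgue_measure R).
Implicit Types (t s z v h nu r : R) (q k m : nat).

(** Scaling by a = sqrt(nu / s) reduces this to [gauss_taylor_remainder] with w = a z and b = a h;
    the assumption h^2 < s is what bounds b by sqrt nu. The 2q terms give b^(2q) = (nu h^2 /
    s)^q. *)
Lemma gauss_local_remainder nu q : 0 < nu -> exists2 C : R, 0 <= C &
  forall h s z v, 0 < h -> h ^+ 2 < s -> 0 <= z ->
    `|v| <= 2 * z * h + h ^+ 2 ->
    `|expR (- (nu * (z ^+ 2 + v) / s)) - expR (- (nu * z ^+ 2 / s)) *
       \sum_(m < (2 * q)%N) (- (nu * v / s)) ^+ m / m`!%:R|
    <= C * (h ^+ 2 / s) ^+ q.
Proof.
move=> nu0; pose B := Num.sqrt nu.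
exists ((2 * q)`!%:R * expR ((1 + B) ^+ 2 + B + B ^+ 2) * nu ^+ q).
  by rewrite !mulr_ge0 ?expR_ge0 ?ler0n ?exprn_ge0// ltW.
move=> h s z v h0 hs z0 vh.
have s0 : 0 < s by apply: le_lt_trans hs; exact: sqr_ge0.
pose a := Num.sqrt (nu / s).
have a0 : 0 <= a by exact: sqrtr_ge0.
have a2 : a ^+ 2 = nu / s by rewrite sqr_sqrtr// divr_ge0 ?ltW.
have eA : nu * z ^+ 2 / s = (a * z) ^+ 2.
  by rewrite exprMn a2; field; rewrite gt_eqF.
have eE : - (nu * (z ^+ 2 + v) / s) = - (a * z) ^+ 2 + - (nu * v / s).
  by rewrite exprMn a2; field; rewrite gt_eqF.
rewrite eE eA expRD -mulrBr normrM ger0_norm ?expR_ge0//.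
have ah : (a * h) ^+ 2 <= nu.
  rewrite exprMn a2 mulrAC ler_pdivrMr//; apply: ler_wpM2l; exact: ltW.
have := @gauss_taylor_remainder R (2 * q)%N B (a * z) (a * h) (- (nu * v / s)).
move=> /(_ (mulr_ge0 a0 z0)); have -> : 0 <= a * h <= B.
  rewrite mulr_ge0 ?(ltW h0)//= -ler_sqr ?nnegrE ?sqrtr_ge0 ?mulr_ge0 ?(ltW
    h0)//.
  by rewrite sqr_sqrtr// ltW.
move=> /(_ isT) H; apply: le_trans (H _) _.
  rewrite normrN !normrM (gtr0_norm nu0) (@gtr0_norm _ s^-1) ?invr_gt0//.
  have -> : nu * `|v| / s = a ^+ 2 * `|v| by rewrite a2; field; rewrite gt_eqF.
  have -> : 2 * (a * z) * (a * h) + (a * h) ^+ 2 = a ^+ 2 * (2 * z * h + h ^+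
    2).
    by ring.
  by apply: ler_wpM2l; rewrite ?exprn_ge0.
have e2 : (a * h) ^+ 2 = nu * (h ^+ 2 / s) by rewrite exprMn a2; ring.
by rewrite exprM e2 exprMn mulrA.
Qed.

Lemma le_Rintegral_EFin (D : set R) (f : R -> R) (M : R) : measurable D ->
  leb.-integrable D (EFin \o f) ->
  (\int[leb]_(s in D) (f s)%:E <= M%:E)%E -> (\int[leb]_(s in D) f s)%R <= M.
Proof.
by move=> mD fi fM; rewrite -lee_fin /Rintegral fineK//;
  exact: integrable_fin_num.
Qed.

(** The order of the quantifiers matters: [k] and [C] depend on nu alone, and the coefficients on h
    and z but not on v. With z = |y - c| they are functions of y, which separates y from x. *)
Lemma matern_local_approx nu : 0 < nu -> exists k : nat, exists2 C : R, 0 < C &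
  forall h z, 0 < h -> 0 <= z -> exists a : nat -> R,
  forall r v, 0 <= r -> r ^+ 2 = z ^+ 2 + v -> `|v| <= 2 * z * h + h ^+ 2 ->
    `|matern nu r - \sum_(m < k) a m * v ^+ m| <= C * h `^ (2 * nu).
Proof.
move=> nu0; pose q := (Num.truncn nu).+1.
have nuq : nu < q%:R by exact: truncnS_gt.
have qnu : 0 < q%:R - nu by rewrite subr_gt0.
have [C0 C00 HC] := gauss_local_remainder q nu0.
have G0 := Gamma_gt0 nu0.
(* The integral of s^(nu-1) over s <= h^2 is h^(2 nu) / nu, and that of s^(nu-1) (h^2/s)^q over s >
   h^2 is h^(2 nu) / (q - nu). *)
exists (2 * q)%N; exists ((Gamma nu)^-1 * (nu^-1 + C0 / (q%:R - nu))).
  by rewrite mulr_gt0 ?invr_gt0// ltr_wpDr ?invr_gt0// divr_ge0// ltW.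
move=> h z h0 z0.
have h20 : 0 < h ^+ 2 by rewrite exprn_gt0.
(* The coefficients come from s > h^2 only; the whole contribution of s <= h^2 is counted as
   error. *)
pose I m := \int[leb]_(s in `]h ^+ 2, +oo[)
  (gamma_weight nu s * (expR (- (nu * z ^+ 2 / s)) * (- (nu / s)) ^+ m)).
exists (fun m => (Gamma nu)^-1 * (I m / m`!%:R)) => r v r0 rv vh.
pose b1 s := expR (- (nu * r ^+ 2 / s)).
pose b2 m s := expR (- (nu * z ^+ 2 / s)) * (- (nu / s)) ^+ m.
have mdiv (A : R) : measurable_fun [set: R] (fun s : R => - (A / s)).
  apply: measurable_funN; apply: measurable_funM => //; exact: measurable_invr.
have mb1 : measurable_fun [set: R] b1 by exact: measurableT_comp.
have mb2 m : measurable_fun [set: R] (b2 m).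
  apply: measurable_funM; first exact: measurableT_comp.
  exact: measurable_funX.
have D1 : (`]0, h ^+ 2]%classic : set R) `<=` `]0, +oo[%classic.
  by move=> s /=; rewrite !in_itv/= => /andP[->].
have D2 : (`]h ^+ 2, +oo[%classic : set R) `<=` `]0, +oo[%classic.
  by move=> s /=; rewrite !in_itv/= !andbT; exact: lt_trans.
have b1le s : 0 < s -> `|b1 s| <= 1.
  move=> s0; rewrite ger0_norm ?expR_ge0// -expR0 ler_expR oppr_le0.
  by rewrite divr_ge0 ?mulr_ge0 ?exprn_ge0// ltW.
have ib1 (D : set R) : measurable D -> D `<=` `]0, +oo[%classic ->
    leb.-integrable D (EFin \o (fun s => gamma_weight nu s * b1 s)).
  move=> mD D0; apply: (@integrable_gamma_weightM _ _ _ _ 1) => // s /D0/=.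
  by rewrite in_itv/= andbT; exact: b1le.
have ib2 m : leb.-integrable `]h ^+ 2, +oo[
    (EFin \o (fun s => gamma_weight nu s * b2 m s)).
  apply: (@integrable_gamma_weightM _ _ _ _ ((nu / h ^+ 2) ^+ m)) => // s /=.
  rewrite in_itv/= andbT => hs; have s0 : 0 < s by exact: lt_trans hs.
  rewrite normrM normrX normrN ger0_norm ?expR_ge0//.
  have nus : 0 <= nu / s by rewrite divr_ge0// ltW.
  rewrite (@ger0_norm _ (nu / s))// -[leRHS]mul1r.
  apply: ler_pM; rewrite ?expR_ge0 ?exprn_ge0//.
    rewrite -expR0 ler_expR oppr_le0 mulrAC.
    by rewrite mulr_ge0// exprn_ge0.
  have sh : nu / s <= nu / h ^+ 2 by rewrite ler_pM2l// lef_pV2 ?posrE// ltW.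
  by rewrite lerXn2r ?nnegrE// (le_trans nus).
rewrite matern_mixture//.
have -> : \sum_(m < 2 * q) (Gamma nu)^-1 * (I m / m`!%:R) * v ^+ m =
    (Gamma nu)^-1 * \sum_(m < 2 * q) (I m / m`!%:R * v ^+ m).
  by rewrite mulr_sumr; apply: eq_bigr => m _; rewrite -!mulrA.
rewrite -mulrBr normrM (@ger0_norm _ (Gamma nu)^-1) ?invr_ge0 ?(ltW G0)//.
rewrite -!mulrA ler_pM2l ?invr_gt0//.
pose S s := \sum_(m < (2 * q)%N) (- (nu * v / s)) ^+ m / m`!%:R.
pose b3 s := expR (- (nu * z ^+ 2 / s)) * S s.
have b3E s : gamma_weight nu s * b3 s =
    \sum_(m < (2 * q)%N) (v ^+ m / m`!%:R) * (gamma_weight nu s * b2 m s).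
  rewrite /b3 /S !mulr_sumr; apply: eq_bigr => m _; rewrite /b2.
  have -> : - (nu * v / s) = v * - (nu / s) by ring.
  by rewrite exprMn; ring.
pose b4 m s := v ^+ m / m`!%:R * (gamma_weight nu s * b2 m s).
have ib4 m : leb.-integrable `]h ^+ 2, +oo[ (EFin \o b4 m).
  rewrite (_ : EFin \o b4 m = (fun s => (v ^+ m / m`!%:R)%:E *
      (EFin \o (fun s => gamma_weight nu s * b2 m s)%R) s)%E)//.
  by apply: integrableZl => //; exact: ib2.
have ib3 : leb.-integrable `]h ^+ 2, +oo[
    (EFin \o (fun s => gamma_weight nu s * b3 s)).
  rewrite (_ : EFin \o _ = (fun s => \sum_(m < (2 * q)%N)
    (EFin \o b4 m) s)%E); last by apply/funext => s; rewrite /= b3E -sumEFin.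
  by apply: integrable_sum.
have I3 : \int[leb]_(s in `]h ^+ 2, +oo[) (gamma_weight nu s * b3 s) =
    \sum_(m < (2 * q)%N) (I m / m`!%:R * v ^+ m).
  rewrite /Rintegral.
  transitivity (fine (\int[leb]_(s in `](h ^+ 2)%R, +oo[)
      \sum_(m < (2 * q)%N) (EFin \o b4 m) s)).
    by congr fine; apply: eq_integral => s _; rewrite b3E -sumEFin.
  rewrite integral_sum//.
  rewrite -sum_fine; last first.
    by move=> m _; apply: integrable_fin_num => //; exact: ib4.
  apply: eq_bigr => m _.
  rewrite -[LHS]/(\int[leb]_(s in _) (v ^+ m / m`!%:R *
    (gamma_weight nu s * b2 m s)))%R RintegralZl//.
  by rewrite -/(I m); ring.
have -> : gamma_mixture nu (nu * r ^+ 2) =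
    \int[leb]_(s in `]0, h ^+ 2]) (gamma_weight nu s * b1 s) +
    \int[leb]_(s in `]h ^+ 2, +oo[) (gamma_weight nu s * b1 s).
  rewrite /gamma_mixture.
  have {1}-> : `]0, +oo[%classic = `]0, h ^+ 2] `|` `]h ^+ 2, +oo[ :> set R.
    rewrite predeqE => s /=; rewrite !in_itv/= !andbT; split.
      by move=> ->; case: (leP s (h ^+ 2)) => _; [left|right].
    by move=> [/andP[]//|]; exact: lt_trans.
  rewrite Rintegral_setU//.
    apply: ib1; first exact: measurableU.
    by move=> s [/D1|/D2].
  rewrite disj_set2E; apply/eqP; rewrite predeqE => s; split => //= -[].
  by rewrite !in_itv/= andbT => /andP[_ s1] /(le_lt_trans s1); rewrite ltxx.
rewrite -I3 -addrA -RintegralB//; last exact: ib1.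
have h2nu : (h ^+ 2) `^ nu = h `^ (2 * nu).
  by rewrite powRrM powR_mulrn// ltW.
rewrite [leRHS]mulrDl; apply: le_trans (ler_normD _ _) _; apply: lerD.
  rewrite ger0_norm; last first.
    apply: Rintegral_ge0 => s _; rewrite mulr_ge0 ?expR_ge0//.
    exact: gamma_weight_ge0.
  apply: le_Rintegral_EFin => //; first exact: ib1.
  rewrite mulrC -h2nu; apply: le_trans (integral_gamma_weight_near0 nu0 h20).
  apply: ge0_le_integral => //=.
  - move=> s _; rewrite lee_fin mulr_ge0 ?expR_ge0//.
    exact: gamma_weight_ge0.
  - exact: measurable_int (ib1 _ _ D1).
  - apply/measurable_EFinP; apply: measurable_funTS.
    exact: measurable_gamma_weight.
  - move=> s; rewrite in_itv/= => /andP[s0 _]; rewrite lee_fin.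
    rewrite ler_piMr ?gamma_weight_ge0//.
    by apply: le_trans (ler_norm _) _; exact: b1le.
have ib5 : leb.-integrable `]h ^+ 2, +oo[ (EFin \o
    (fun s => gamma_weight nu s * b1 s - gamma_weight nu s * b3 s)).
  have := integrableB _ (ib1 _ _ D2) ib3; apply=> //.
apply: le_trans (le_normr_Rintegral _ _) _ => //.
apply: le_Rintegral_EFin => //; first exact: integrable_norm.
have C1 : 0 <= C0 * (h ^+ 2) ^+ q by rewrite mulr_ge0// exprn_ge0// ltW.
apply: (@le_trans _ _ (\int[leb]_(s in `](h ^+ 2)%R, +oo[)
    ((C0 * (h ^+ 2) ^+ q)%:E * (s `^ (- (q%:R - nu) - 1))%:E))%E).
  apply: ge0_le_integral => //=.
  - apply/measurable_EFinP; apply: measurableT_comp => //.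
    by apply/measurable_EFinP; exact: measurable_int ib5.
  - apply/measurable_EFinP; apply: measurable_funTS.
    by apply: measurable_funM => //; exact: measurable_powR.
  move=> s; rewrite in_itv/= andbT => hs; have s0 : 0 < s by exact: lt_trans hs.
  rewrite -EFinM lee_fin -mulrBr normrM ger0_norm ?gamma_weight_ge0//.
  have := HC h s z v h0 hs z0 vh; rewrite -rv -/(b1 s) -/(S s) -/(b3 s) => Hs.
  apply: le_trans (ler_pM (gamma_weight_ge0 _ _) (normr_ge0 _)
    (le_gamma_weight nu s0) Hs) _.
  have -> : - (q%:R - nu) - 1 = (nu - 1) - q%:R by ring.
  rewrite (@powRB _ s (nu - 1)) ?(gt_eqF s0) ?implybT// powR_mulrn ?(ltW s0)//.
  by rewrite exprMn exprVn le_eqVlt; apply/orP; left; apply/eqP; ring.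
rewrite ge0_integralZl_EFin//=; last 2 first.
- by move=> s _; rewrite lee_fin powR_ge0.
- apply/measurable_EFinP; apply: measurable_funTS; exact: measurable_powR.
apply: le_trans (lee_wpmul2l _ (integral_powR_infty qnu h20)) _.
  by rewrite lee_fin.
rewrite -EFinM lee_fin opprB powRB ?(gt_eqF h20) ?implybT//.
rewrite powR_mulrn ?(ltW h20)// h2nu le_eqVlt; apply/orP; left; apply/eqP.
field; apply/andP; split; rewrite ?gt_eqF// ?exprn_gt0//.
Qed.

End matern_local.

(** * Bounded measurable functions on compact sets *)

Section row_topology.
Context {R : realType} {d : nat}.
Local Notation E := 'rV[R]_d.

Lemma ball_rVP (x y : E) (e : R) : 0 < e ->
  ball x e y <-> forall i, `|x ord0 i - y ord0 i| < e.
Proof.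
move=> e0; split; first by move=> [_ h] i; exact: h.
by move=> h; split => // i j; rewrite (ord1 i); exact: h.
Qed.

(** The sigma-algebra is generated by the coordinates; an open set is the union of the countably
    many rational cubes that it contains. *)
Lemma open_measurable_rV (U : set E) : open U -> measurable U.
Proof.
move=> oU.
pose B (p : 'rV[rat]_d * nat) : set E :=
  [set y | forall i, `|ratr (p.1 ord0 i) - y ord0 i| < p.2.+1%:R^-1].
have mB p : measurable (B p).
  rewrite (_ : B p = \bigcap_(i in [set: 'I_d]) (fun x : E => x ord0 i) @^-1`
     [set s | `|ratr (p.1 ord0 i) - s| < p.2.+1%:R^-1]); last first.
    by rewrite predeqE => y; split => [h i _|h i]; [exact: h|exact: (h i I)].
  apply: fin_bigcap_measurable => // i _.
  rewrite -[X in measurable X]setTI; apply: measurable_coord => //.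
  rewrite (_ : mkset _ = ball (ratr (p.1 ord0 i) : R) p.2.+1%:R^-1)//.
  exact: measurable_ball.
have -> : U = \bigcup_p (if `[< B p `<=` U >] then B p else set0).
  rewrite predeqE => x; split; last first.
    by move=> [p _]; case: asboolP => // BU /BU.
  move=> Ux; have /nbhs_ballP[e /= e0 He] : nbhs x U by exact: open_nbhs_nbhs.
  (* With 2 / (k+1) < e, a cube of radius 1 / (k+1) around a rational point of the same closeness to
     x stays in the ball of radius e. *)
  pose k := Num.truncn (2 / e).
  have ke : k.+1%:R^-1 + k.+1%:R^-1 < e.
    have : 2 / e < k.+1%:R by exact: truncnS_gt.
    rewrite ltr_pdivrMr// mulrC => h.
    by rewrite -mulr2n -[_ *+ 2]mulr_natl ltr_pdivrMr ?ltr0n.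
  have /choice[q Hq] (i : 'I_d) : exists q : rat,
      `|ratr q - x ord0 i| < k.+1%:R^-1.
    have k0 : 0 < k.+1%:R^-1 :> R by rewrite invr_gt0 ltr0n.
    have [|q] := @rat_in_itvoo R (x ord0 i - k.+1%:R^-1) (x ord0 i +
      k.+1%:R^-1).
      by rewrite ltrD2l; apply: lt_trans k0; rewrite oppr_lt0.
    by rewrite in_itv/= -ltr_distlC distrC => hq; exists q.
  exists (\row_i q i, k) => //.
  case: asboolP => [_ i|]; first by rewrite mxE.
  case=> y Hy; apply: He; apply/ball_rVP => // i.
  have := Hy i; rewrite /= mxE => Hyi.
  apply: le_lt_trans ke.
  apply: le_trans (ler_distD (ratr (q i)) _ _) _.
  by apply: lerD; [rewrite distrC|]; apply: ltW.
apply: countable_bigcupT_measurable => [|p]; first exact: countableP.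
by case: asboolP.
Qed.

Lemma compact_measurable_rV (D : set E) : compact D -> measurable D.
Proof.
move=> /(compact_closed (@norm_hausdorff _ _)) cD.
rewrite -(setCK D); apply: measurableC; apply: open_measurable_rV.
exact: closed_openC.
Qed.

Lemma within_continuous_measurable_rV (D : set E) (f : E -> R) :
  measurable D -> {within D, continuous f} -> measurable_fun D f.
Proof.
move=> mD cf; apply: (measurability _ (RGenOpens.measurableE R)).
move=> _ [_ [a [b ->] <-]].
have : open ((f : subspace D -> R) @^-1` `]a, b[).
  by apply: open_comp => // x _; exact: cf.
move=> /open_subspaceP[V oV VD].
rewrite setIC -VD; apply: measurableI => //; exact: open_measurable_rV.
Qed.

Lemma compact_box (D : set E) : compact D -> exists2 B : R, 0 < B &
  forall x, D x -> forall i, `|x ord0 i| < B.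
Proof.
move=> /compact_bounded[M [_ HM]].
have M0 : 0 < Num.max M 0 + 2 by rewrite ltr_wpDl// le_max lexx orbT.
exists (Num.max M 0 + 2) => // x Dx i.
have : `|x| <= Num.max M 0 + 1.
  by apply: HM => //; rewrite ltr_pwDr// le_max lexx.
have : `|x ord0 i| <= `|x|.
  rewrite [X in _ <= X]mx_normrE.
  exact: (le_bigmax _ (fun ij => `|x ij.1 ij.2|) (ord0, i)).
by move=> h1 h2; apply: le_lt_trans (le_trans h1 h2) _; rewrite ltrD2l ltr1n.
Qed.

Lemma compact_finite_measure_rV (D : set E) : compact D ->
  (lebesgue_rV R d D < +oo)%E.
Proof.
move=> cD; have mD := compact_measurable_rV cD.
have [B B0 HB] := compact_box cD.
pose a : E := \row_i (- B); pose b : E := \row_i B.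
pose Q : set E := [set x | forall i, a ord0 i <= x ord0 i <= b ord0 i].
have HQ : _ -> lebesgue_rV R d Q = _ := @lebesgue_rV_box R d a b.
have mQ : measurable Q.
  rewrite (_ : Q = \bigcap_(i in [set: 'I_d])
      (fun x : E => x ord0 i) @^-1` `[a ord0 i, b ord0 i]%classic).
    apply: fin_bigcap_measurable => // i _.
    by rewrite -[X in measurable X]setTI; exact: measurable_coord.
  rewrite predeqE => x; split => [h i _|h i]; first by rewrite /= in_itv/= h.
  by have := h i I; rewrite /= in_itv.
apply: (@le_lt_trans _ _ (lebesgue_rV R d Q)).
  apply: le_measure; rewrite ?inE// => x /HB xB i.
  by rewrite !mxE -ler_norml ltW.
rewrite HQ ?ltry// => i; rewrite !mxE.
by apply: le_trans (ltW B0); rewrite oppr_le0 ltW.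
Qed.

End row_topology.

Section bounded_measurable.
Context {disp} {T : measurableType disp} {R : realType}.
Variables (mu : {measure set T -> \bar R}) (D : set T).
Hypotheses (mD : measurable D) (fD : (mu D < +oo)%E).
Implicit Types f g : T -> R.

(** On a set of finite measure this class consists of integrable functions and, unlike the
    integrable ones, is closed under products; integrability conditions thus reduce to closure
    properties. *)
Definition bounded_mfun f :=
  measurable_fun D f /\ exists M, forall x, D x -> `|f x| <= M.

Lemma bounded_mfun_cst c : bounded_mfun (fun=> c).
Proof. by split; [exact: measurable_cst|exists `|c|]. Qed.

Lemma bounded_mfunD f g : bounded_mfun f -> bounded_mfun g ->
  bounded_mfun (fun x => f x + g x).
Proof.
move=> [mf [M fM]] [mg [N gN]]; split; first exact: measurable_funD.
exists (M + N) => x Dx; apply: le_trans (ler_normD _ _) _.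
by apply: lerD; [exact: fM|exact: gN].
Qed.

Lemma bounded_mfunM f g : bounded_mfun f -> bounded_mfun g ->
  bounded_mfun (fun x => f x * g x).
Proof.
move=> [mf [M fM]] [mg [N gN]]; split; first exact: measurable_funM.
by exists (M * N) => x Dx; rewrite normrM; apply: ler_pM => //; auto.
Qed.

Lemma bounded_mfunZ c f : bounded_mfun f -> bounded_mfun (fun x => c * f x).
Proof. by move=> bf; apply: bounded_mfunM => //; exact: bounded_mfun_cst. Qed.

Lemma bounded_mfunB f g : bounded_mfun f -> bounded_mfun g ->
  bounded_mfun (fun x => f x - g x).
Proof.
move=> bf bg; apply: bounded_mfunD => //.
have -> : (fun x => - g x) = (fun x => -1 * g x).
  by apply/funext => x; rewrite mulN1r.
exact: bounded_mfunZ.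
Qed.

Lemma bounded_mfun_norm f : bounded_mfun f -> bounded_mfun (fun x => `|f x|).
Proof.
move=> [mf [M fM]]; split; first exact: measurableT_comp.
by exists M => x Dx; rewrite normr_id; exact: fM.
Qed.

Lemma bounded_mfunX f n : bounded_mfun f -> bounded_mfun (fun x => f x ^+ n).
Proof.
move=> bf; elim: n => [|n IH].
  by under eq_fun do rewrite expr0; exact: bounded_mfun_cst.
by under eq_fun do rewrite exprS; exact: bounded_mfunM.
Qed.

Lemma bounded_mfun_sum (I : Type) (s : seq I) (P : pred I) (F : I -> T -> R) :
  (forall i, P i -> bounded_mfun (F i)) ->
  bounded_mfun (fun x => \sum_(i <- s | P i) F i x).
Proof.
move=> bF; elim: s => [|i s IH].
  by under eq_fun do rewrite big_nil; exact: bounded_mfun_cst.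
under eq_fun do rewrite big_cons.
by case: (boolP (P i)) => // Pi; apply: bounded_mfunD => //; exact: bF.
Qed.

Lemma bounded_mfun_prod (I : Type) (s : seq I) (P : pred I) (F : I -> T -> R) :
  (forall i, P i -> bounded_mfun (F i)) ->
  bounded_mfun (fun x => \prod_(i <- s | P i) F i x).
Proof.
move=> bF; elim: s => [|i s IH].
  by under eq_fun do rewrite big_nil; exact: bounded_mfun_cst.
under eq_fun do rewrite big_cons.
by case: (boolP (P i)) => // Pi; apply: bounded_mfunM => //; exact: bF.
Qed.

Lemma bounded_mfun_integrable f : bounded_mfun f ->
  mu.-integrable D (EFin \o f).
Proof.
move=> [mf [M fM]]; apply: measurable_bounded_integrable => //.
exists M; split; first exact: num_real.
by move=> N MN x Dx; apply: le_trans (fM _ Dx) (ltW MN).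
Qed.

Lemma Rintegral_sum_bounded (I : Type) (s : seq I) (P : pred I)
    (F : I -> T -> R) :
  (forall i, P i -> bounded_mfun (F i)) ->
  (\int[mu]_(x in D) \sum_(i <- s | P i) F i x
   = \sum_(i <- s | P i) \int[mu]_(x in D) F i x)%R.
Proof.
move=> bF; elim: s => [|i s IH].
  rewrite big_nil; under eq_Rintegral do rewrite big_nil.
  by rewrite Rintegral_cst// mul0r.
rewrite big_cons; under eq_Rintegral do rewrite big_cons.
case: (boolP (P i)) => // Pi; rewrite RintegralD ?IH//.
  by apply: bounded_mfun_integrable; exact: bF.
by apply: bounded_mfun_integrable; exact: bounded_mfun_sum.
Qed.

Lemma RintegralZ_bounded c f : bounded_mfun f ->
  (\int[mu]_(x in D) (c * f x) = c * \int[mu]_(x in D) f x)%R.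
Proof. by move=> bf; rewrite RintegralZl//; exact: bounded_mfun_integrable. Qed.

Lemma norm_Rintegral_le f M : bounded_mfun f ->
  (forall x, D x -> `|f x| <= M) ->
  `|\int[mu]_(x in D) f x| <= M * fine (mu D).
Proof.
move=> bf fM; rewrite -Rintegral_cst//.
apply: le_trans (le_normr_Rintegral _ _) _ => //.
  exact: bounded_mfun_integrable.
apply: le_Rintegral => //; apply: bounded_mfun_integrable.
  exact: bounded_mfun_norm.
exact: bounded_mfun_cst.
Qed.

Lemma Rintegral_norm_sqr_le f : bounded_mfun f -> (0 < mu D)%E ->
  (\int[mu]_(x in D) `|f x|) ^+ 2 <= fine (mu D) * \int[mu]_(x in D) f x ^+ 2.
Proof.
move=> bf D0; set A := (\int[mu]_(x in D) _)%R;
  set B := (\int[mu]_(x in D) _)%R.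
set m := fine (mu D); have m0 : 0 < m by rewrite fine_gt0// D0.
(* Cauchy-Schwarz against the constant 1, obtained as the nonnegative variance of |f| about its mean
   A / m. *)
have : 0 <= (\int[mu]_(x in D) (`|f x| - A / m) ^+ 2)%R.
  by apply: Rintegral_ge0 => x _; exact: sqr_ge0.
have -> : (\int[mu]_(x in D) (`|f x| - A / m) ^+ 2)%R =
    (\int[mu]_(x in D) (f x ^+ 2 + (- (2 * A / m) * `|f x| + (A / m) ^+ 2)))%R.
  by apply: eq_Rintegral => x _; rewrite sqrrB real_normK ?num_real//; ring.
have i1 := bounded_mfun_integrable (bounded_mfunX 2 bf).
have b2 := bounded_mfunZ (- (2 * A / m)) (bounded_mfun_norm bf).
have b3 := bounded_mfun_cst ((A / m) ^+ 2).
rewrite RintegralD//; last exact: bounded_mfun_integrable (bounded_mfunD b2 b3).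
rewrite RintegralD//; [|exact: bounded_mfun_integrable..].
rewrite RintegralZ_bounded; last exact: bounded_mfun_norm.
rewrite Rintegral_cst// -/A -/B -/m => H.
have -> : m * B = m * (B + (- (2 * A / m) * A + (A / m) ^+ 2 * m)) + A ^+ 2.
  by field; rewrite gt_eqF.
by rewrite lerDr mulr_ge0// ltW.
Qed.

End bounded_measurable.

(** * Mercer systems *)

Section bounded_convergence.
Context {disp} {T : measurableType disp} {R : realType}.
Variables (mu : {measure set T -> \bar R}) (D : set T).
Hypotheses (mD : measurable D) (fD : (mu D < +oo)%E).

Lemma bounded_mfun_cvg (f_ : nat -> T -> R) (f : T -> R) (M : R) :
  (forall m, bounded_mfun D (f_ m)) ->
  (forall m x, D x -> `|f_ m x| <= M) ->
  (forall x, D x -> f_ m x @[m --> \oo] --> f x) ->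
  bounded_mfun D f.
Proof.
move=> bf fM cf; split.
  by apply: (@measurable_fun_cvg _ _ _ _ f_) => // m; have [] := bf m.
exists M => x Dx; have cn : `|f_ m x| @[m --> \oo] --> `|f x| by apply:
  cvg_norm; exact: cf.
rewrite -(cvg_lim _ cn)//; apply: limr_le; first by apply/cvg_ex; eexists;
  exact: cn.
by near=> m; exact: fM.
Unshelve. all: by end_near. Qed.

Lemma Rintegral_bounded_cvg (f_ : nat -> T -> R) (f : T -> R) (M : R) :
  (forall m, bounded_mfun D (f_ m)) ->
  (forall m x, D x -> `|f_ m x| <= M) ->
  (forall x, D x -> f_ m x @[m --> \oo] --> f x) ->
  (\int[mu]_(x in D) f_ m x)%R @[m --> \oo] --> (\int[mu]_(x in D) f x)%R.
Proof.
move=> bf fM cf; have bff := bounded_mfun_cvg bf fM cf.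
have H : (\int[mu]_(x in D) (f_ m x)%:E)%E @[m --> \oo] -->
    (\int[mu]_(x in D) (f x)%:E)%E.
  apply: (@dominated_cvg _ _ _ mu D mD (fun m => EFin \o f_ m) (EFin \o f)
    (cst M%:E)) => //.
  - by move=> m; apply/measurable_EFinP; have [] := bf m.
  - by move=> x Dx; apply/cvg_EFin; [near=> m|exact: cf].
  - have := bounded_mfun_integrable mD fD (bounded_mfun_cst D M).
    by apply: eq_integrable.
have fin (g : T -> R) : bounded_mfun D g ->
    (\int[mu]_(x in D) (g x)%:E)%E = (\int[mu]_(x in D) g x)%R%:E.
  move=> bg; rewrite /Rintegral fineK//; apply: integrable_fin_num => //.
  exact: bounded_mfun_integrable.
rewrite fin// in H.
exact: (fine_cvg H).
Unshelve. all: by end_near. Qed.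

End bounded_convergence.

Section mercer.
Context {R : realType} {d : nat}.
Local Notation E := 'rV[R]_d.
Local Notation mu := (lebesgue_rV R d).
Variables (Omega : set E) (Psi : E -> E -> R) (lambda : nat -> R)
  (phi : nat -> E -> R).
Hypotheses (mO : measurable Omega) (fO : (mu Omega < +oo)%E)
  (pO : (0 < mu Omega)%E) (cO : compact Omega).
Hypothesis eig : mercer_system Omega Psi lambda phi.
Hypothesis Psi1 : forall x, Omega x -> Psi x x = 1.
Local Notation bm := (bounded_mfun Omega).
Implicit Types (g u : E -> R) (x y : E) (i j m n : nat).

Definition fourier_coef g j : R := \int[mu]_(x in Omega) (g x * phi j x).
Local Notation coef := fourier_coef.

Lemma continuous_bounded_mfun g : {within Omega, continuous g} -> bm g.
Proof.
move=> cg; split; first exact: within_continuous_measurable_rV.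
have : compact (g @` Omega) by apply: continuous_compact.
move=> /compact_bounded[M [_ HM]]; exists (M + 1) => x Ox.
by apply: HM; [rewrite ltrDl|exists x].
Qed.

Lemma bm_phi j : bm (phi j).
Proof. by apply: continuous_bounded_mfun; exact: (mercer_continuous eig). Qed.

Let bm_phiM g j : bm g -> bm (fun x => g x * phi j x).
Proof. by move=> bg; apply: bounded_mfunM => //; exact: bm_phi. Qed.

Let psum m x y : R := \sum_(0 <= j < m) lambda j * phi j x * phi j y.

Let psum_diag_le1 m x : Omega x -> psum m x x <= 1.
Proof.
move=> Ox; rewrite -(Psi1 Ox).
have cv := mercer_expansion eig Ox Ox.
rewrite -(cvg_lim _ cv)//; apply: (@nondecreasing_cvgn_le _ (psum ^~ x ^~ x)).
  apply: nondecreasing_series => j _ _.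
  by rewrite -mulrA mulr_ge0 ?(ltW (mercer_gt0 eig j))// -expr2 sqr_ge0.
by apply/cvg_ex; eexists; exact: cv.
Qed.

(** By 2 |a b| <= a^2 + b^2 in each term, the diagonal sums dominate, and these increase to Psi(x,
    x) = 1. This uniform bound allows the pointwise expansion to be integrated. *)
Let psum_le1 m x y : Omega x -> Omega y -> `|psum m x y| <= 1.
Proof.
move=> Ox Oy; have hx := psum_diag_le1 m Ox; have hy := psum_diag_le1 m Oy.
apply: (@le_trans _ _ ((psum m x x + psum m y y) / 2)); last by lra.
rewrite /psum -big_split/= mulr_suml.
apply: le_trans (ler_norm_sum _ _ _) _; apply: ler_sum => j _.
have l0 := ltW (mercer_gt0 eig j).
rewrite -!mulrA -mulrDr -mulrA normrM (ger0_norm l0); apply: ler_wpM2l => //.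
rewrite normrM -!expr2 -(real_normK (num_real (phi j x))).
rewrite -(real_normK (num_real (phi j y))).
have := sqr_ge0 (`|phi j x| - `|phi j y|); nra.
Qed.

Lemma mercer_bounded x : Omega x -> bm (Psi x).
Proof.
move=> Ox; apply: (@bounded_mfun_cvg _ _ _ _ (fun m y => psum m x y) _ 1).
- move=> m; apply: bounded_mfun_sum => j _.
  by apply: bounded_mfunZ; exact: bm_phi.
- by move=> m y Oy; exact: psum_le1.
- by move=> y Oy; exact: (mercer_expansion eig).
Qed.

Lemma mercer_sym x y : Omega x -> Omega y -> Psi x y = Psi y x.
Proof.
move=> Ox Oy; have c1 := mercer_expansion eig Ox Oy.
have c2 := mercer_expansion eig Oy Ox.
rewrite -(cvg_lim _ c1)// -(cvg_lim _ c2)//; congr (lim (_ @ \oo)).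
by apply/funext => m; apply: eq_bigr => j _; rewrite mulrAC.
Qed.

Lemma cov_kernel_phi g j : bm g ->
  cov_kernel Omega Psi (phi j) g = lambda j * coef g j.
Proof.
move=> bg; rewrite /cov_kernel /fourier_coef.
rewrite -(RintegralZ_bounded mO fO); last exact: bm_phiM.
apply: eq_Rintegral => y /set_mem Oy.
(* The inner integral of [cov_kernel] is over the first argument of the kernel, that of
   [mercer_eigen] over the second. *)
transitivity (\int[mu]_(x in Omega) (g y * (phi j x * Psi y x))).
  by apply: eq_Rintegral => x /set_mem Ox; rewrite (mercer_sym Oy Ox); ring.
rewrite (RintegralZ_bounded mO fO); last first.
  by apply: bounded_mfunM; [exact: bm_phi|exact: mercer_bounded].
by rewrite (mercer_eigen eig)//; ring.
Qed.

(** Bounded convergence is applied twice, to the inner integral at each y and then to the outer one,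
    with [s m] the inner integral of the truncated kernel. *)
Lemma cov_kernel_cvg g : bm g ->
  (\sum_(0 <= j < m) lambda j * coef g j ^+ 2) @[m --> \oo] -->
    cov_kernel Omega Psi g g.
Proof.
move=> bg; have [_ [G HG]] := bg.
pose s m y := \sum_(0 <= j < m) (lambda j * coef g j) * (g y * phi j y).
have bs m : bm (s m).
  apply: bounded_mfun_sum => j _; apply: bounded_mfunZ; exact: bm_phiM.
have sE m y : s m y = \int[mu]_(x in Omega) (g x * g y * psum m x y).
  have -> : (\int[mu]_(x in Omega) (g x * g y * psum m x y)) =
      \int[mu]_(x in Omega)
        \sum_(0 <= j < m) (g y * lambda j * phi j y) * (g x * phi j x).
    apply: eq_Rintegral => x _; rewrite /psum mulr_sumr.
    by apply: eq_bigr => j _; ring.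
  rewrite (Rintegral_sum_bounded mO fO); last first.
    by move=> j _; apply: bounded_mfunZ; exact: bm_phiM.
  apply: eq_bigr => j _; rewrite (RintegralZ_bounded mO fO)//;
    last exact: bm_phiM.
  by rewrite -/(coef g j); ring.
have gG m x y : Omega x -> Omega y -> `|g x * g y * psum m x y| <= G * G * 1.
  move=> Ox Oy; rewrite !normrM; apply: ler_pM; rewrite ?mulr_ge0//;
    last exact: psum_le1.
  by apply: ler_pM => //; exact: HG.
have bgp m y : Omega y -> bm (fun x => g x * g y * psum m x y).
  move=> Oy; apply: bounded_mfunM.
    by apply: bounded_mfunM => //; exact: bounded_mfun_cst.
  apply: bounded_mfun_sum => j _; apply: bounded_mfunM;
    last exact: bounded_mfun_cst.
  by apply: bounded_mfunZ; exact: bm_phi.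
have -> : (fun m => \sum_(0 <= j < m) lambda j * coef g j ^+ 2) =
    (fun m => \int[mu]_(y in Omega) s m y).
  apply/funext => m; rewrite (Rintegral_sum_bounded mO fO); last first.
    by move=> j _; apply: bounded_mfunZ; exact: bm_phiM.
  apply: eq_bigr => j _; rewrite (RintegralZ_bounded mO fO);
    last exact: bm_phiM.
  by rewrite -/(coef g j); ring.
apply: (@Rintegral_bounded_cvg _ _ _ mu Omega mO fO s _ (G * G * 1 * fine (mu
  Omega))).
- exact: bs.
- move=> m y Oy; rewrite sE; apply: norm_Rintegral_le => //; first exact: bgp.
  by move=> x Ox; exact: gG.
- move=> y Oy; under eq_fun do rewrite sE.
  apply: (@Rintegral_bounded_cvg _ _ _ mu Omega mO fO _ _ (G * G * 1)).
  + by move=> m; exact: bgp.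
  + by move=> m x Ox; exact: gG.
  + move=> x Ox; apply: cvgMr => //; exact: (mercer_expansion eig).
Qed.

Lemma fourier_coef_sum n (c : nat -> R) j :
  coef (fun x => \sum_(0 <= i < n) c i * phi i x) j =
    if (j < n)%N then c j else 0.
Proof.
rewrite /fourier_coef.
have -> : (\int[mu]_(x in Omega) ((\sum_(0 <= i < n) c i * phi i x) * phi j x))
  =
    \int[mu]_(x in Omega) (\sum_(0 <= i < n) c i * (phi i x * phi j x)).
  apply: eq_Rintegral => x _; rewrite mulr_suml.
  by apply: eq_bigr => i _; rewrite mulrA.
rewrite (Rintegral_sum_bounded mO fO); last first.
  by move=> i _; apply: bounded_mfunZ; apply: bm_phiM; exact: bm_phi.
under eq_bigr => i _.
  rewrite (RintegralZ_bounded mO fO); last by apply: bm_phiM; exact: bm_phi.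
  rewrite (mercer_orthonormal eig).
  over.
case: ifPn => jn.
  rewrite big_mkord (bigD1 (Ordinal jn))//= eqxx mulr1 big1 ?addr0// => i.
  by rewrite -val_eqE/= => /negPf ->; rewrite mulr0.
rewrite big_nat big1// => i /andP[_ iln].
by rewrite (_ : (i == j) = false) ?mulr0//; apply: contraNF jn => /eqP <-.
Qed.

Lemma bm_sum_phi n (c : nat -> R) : bm (fun x => \sum_(0 <= i < n) c i * phi i
  x).
Proof.
by apply: bounded_mfun_sum => i _; apply: bounded_mfunZ; exact: bm_phi.
Qed.

Lemma Rintegral_sum_phi g n (c : nat -> R) : bm g ->
  \int[mu]_(x in Omega) (g x * \sum_(0 <= i < n) c i * phi i x) =
  \sum_(0 <= i < n) c i * coef g i.
Proof.
move=> bg.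
have -> : (\int[mu]_(x in Omega) (g x * \sum_(0 <= i < n) c i * phi i x)) =
    \int[mu]_(x in Omega) (\sum_(0 <= i < n) c i * (g x * phi i x)).
  apply: eq_Rintegral => x _; rewrite mulr_sumr.
  by apply: eq_bigr => i _; ring.
rewrite (Rintegral_sum_bounded mO fO); last first.
  by move=> i _; apply: bounded_mfunZ; exact: bm_phiM.
by apply: eq_bigr => i _; rewrite (RintegralZ_bounded mO fO)//; exact: bm_phiM.
Qed.

Lemma bessel g n : bm g ->
  \sum_(0 <= j < n) coef g j ^+ 2 <= \int[mu]_(x in Omega) (g x ^+ 2).
Proof.
move=> bg; pose p x := \sum_(0 <= i < n) coef g i * phi i x.
have bp : bm p by exact: bm_sum_phi.
have Igp : \int[mu]_(x in Omega) (g x * p x) = \sum_(0 <= j < n) coef g j ^+ 2.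
  by rewrite Rintegral_sum_phi//; apply: eq_bigr => j _; rewrite expr2.
have Ipp : \int[mu]_(x in Omega) (p x * p x) = \sum_(0 <= j < n) coef g j ^+ 2.
  rewrite Rintegral_sum_phi// !big_nat; apply: eq_bigr => j /andP[_ jn].
  by rewrite fourier_coef_sum jn expr2.
have : 0 <= \int[mu]_(x in Omega) ((g x - p x) ^+ 2).
  by apply: Rintegral_ge0 => x _; exact: sqr_ge0.
have -> : \int[mu]_(x in Omega) ((g x - p x) ^+ 2) =
    \int[mu]_(x in Omega) ((g x ^+ 2 - 2 * (g x * p x)) + p x * p x).
  by apply: eq_Rintegral => x _; ring.
have bgp := bounded_mfunM bg bp; have b2 := bounded_mfunX 2 bg.
have b3 := bounded_mfunZ 2 bgp; have b4 := bounded_mfunM bp bp.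
rewrite RintegralD//; last 2 first.
- by apply: (bounded_mfun_integrable mO fO); exact: bounded_mfunB.
- exact: (bounded_mfun_integrable mO fO).
rewrite RintegralB//; [|exact: (bounded_mfun_integrable mO fO)..].
rewrite (RintegralZ_bounded mO fO)// Igp Ipp; lra.
Qed.

Lemma cov_kernel_tail g n (b : R) : bm g ->
  (forall m, (n <= m)%N -> \sum_(n <= j < m) lambda j * coef g j ^+ 2 <= b) ->
  cov_kernel Omega Psi g g - \sum_(0 <= j < n) lambda j * coef g j ^+ 2 <= b.
Proof.
move=> bg Hb; rewrite lerBlDl; have cv := cov_kernel_cvg bg.
rewrite -(cvg_lim _ cv)//; apply: limr_le; first by apply/cvg_ex; eexists;
  exact: cv.
near=> m; have nm : (n <= m)%N by near: m; exists n.
by rewrite (big_cat_nat (leq0n n) nm)/= lerD2l Hb.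
Unshelve. all: by end_near. Qed.

(** Let T be the integral operator and u a nonzero combination of phi_0, ..., phi_n orthogonal to
    every [beta p]. Then lambda_n |u|^2 <= <u, T u>. For fixed y the integral in x annihilates the
    finite-rank part, so |T u(y)| <= eps |u|_1, and <u, T u> <= eps |u|_1^2 <= eps mu(Omega)
    |u|^2. *)
Lemma eigenvalue_low_rank n (J : finType) (beta : J -> E -> R)
    (alpha : J -> E -> R) (eps : R) :
  (#|J| <= n)%N -> (forall p, bm (beta p)) -> 0 <= eps ->
  (forall x y, Omega x -> Omega y ->
    `|Psi y x - \sum_p alpha p y * beta p x| <= eps) ->
  lambda n <= eps * fine (mu Omega).
Proof.
move=> Jn bb eps0 Heps.
pose A : 'M[R]_(n.+1, #|J|) :=
  \matrix_(i, p) coef (beta (enum_val p)) i.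
(* There are n + 1 unknown coefficients and at most n linear conditions. *)
have [v vA v0] : exists2 v : 'rV[R]_n.+1, v *m A = 0 & v != 0.
  have : kermx A != 0.
    rewrite -mxrank_eq0 mxrank_ker subn_eq0 -ltnNge.
    by apply: leq_ltn_trans (rank_leq_col _) _.
  move=> /rowV0Pn[v /sub_kermxP vA v0]; by exists v.
(* The lemmas on sums of [phi] take coefficients indexed by all natural numbers, so [v] is extended
   by 0. *)
pose c i := if insub i is Some k then v ord0 k else 0.
have cE (i : 'I_n.+1) : c i = v ord0 i by rewrite /c valK.
pose u x := \sum_(0 <= i < n.+1) c i * phi i x.
have bu : bm u by exact: bm_sum_phi.
have ub p : \int[mu]_(x in Omega) (beta p x * u x) = 0.
  rewrite Rintegral_sum_phi// big_mkord.
  have /matrixP/(_ ord0 (enum_rank p)) := vA; rewrite !mxE => vAp.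
  rewrite -[RHS]vAp.
  by apply: eq_bigr => i _; rewrite cE !mxE enum_rankK.
pose S := \sum_(0 <= i < n.+1) c i ^+ 2.
have S0 : 0 < S.
  have [i vi] : exists i : 'I_n.+1, v ord0 i != 0 by apply/rV0Pn.
  rewrite /S big_mkord (bigD1 i)//= ltr_pwDl//.
    by rewrite cE exprn_even_gt0.
  by apply: sumr_ge0 => k _; exact: sqr_ge0.
have Iuu : \int[mu]_(x in Omega) (u x ^+ 2) = S.
  under eq_Rintegral do rewrite expr2.
  rewrite Rintegral_sum_phi// /S !big_nat; apply: eq_bigr => j /andP[_ jn].
  by rewrite fourier_coef_sum jn expr2.
set I1 := (\int[mu]_(x in Omega) `|u x|)%R.
have I10 : 0 <= I1 by apply: Rintegral_ge0.
have Tu y : Omega y -> `|\sum_(0 <= i < n.+1) c i * (lambda i * phi i y)| <=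
  eps * I1.
  move=> Oy.
  have -> : \sum_(0 <= i < n.+1) c i * (lambda i * phi i y) =
      \int[mu]_(x in Omega) (Psi y x * u x).
    rewrite Rintegral_sum_phi; last exact: mercer_bounded.
    apply: eq_bigr => i _; rewrite -(mercer_eigen eig)// /fourier_coef;
      congr (_ * _).
    by apply: eq_Rintegral => x _; rewrite mulrC.
  have bF : bm (fun x => \sum_p alpha p y * (beta p x * u x)).
    apply: bounded_mfun_sum => p _; apply: bounded_mfunZ.
    exact: bounded_mfunM.
  have bP : bm (fun x => Psi y x * u x).
    by apply: bounded_mfunM => //; exact: mercer_bounded.
  have -> : \int[mu]_(x in Omega) (Psi y x * u x) =
      \int[mu]_(x in Omega) (Psi y x * u x - \sum_p alpha p y * (beta p x * u
        x)).
    rewrite RintegralB//; [|exact: (bounded_mfun_integrable mO fO)..].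
    rewrite [X in _ = _ - X](Rintegral_sum_bounded mO fO); last first.
      by move=> p _; apply: bounded_mfunZ => //; exact: bounded_mfunM.
    rewrite [X in _ = _ - X]big1 ?subr0// => p _.
    by rewrite (RintegralZ_bounded mO fO) ?ub ?mulr0//; exact: bounded_mfunM.
  have bPF := bounded_mfunB bP bF.
  apply: le_trans (le_normr_Rintegral _ _) _ => //.
    exact: (bounded_mfun_integrable mO fO).
  rewrite -(RintegralZ_bounded mO fO); last exact: bounded_mfun_norm.
  apply: le_Rintegral => //.
  - by apply: (bounded_mfun_integrable mO fO); exact: bounded_mfun_norm.
  - apply: (bounded_mfun_integrable mO fO); apply: bounded_mfunZ => //.
    exact: bounded_mfun_norm.
  - move=> x Ox.
    have -> : \sum_p alpha p y * (beta p x * u x) = (\sum_p alpha p y * beta p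
      x) * u x.
      by rewrite mulr_suml; apply: eq_bigr => p _; rewrite mulrA.
    by rewrite -mulrBl normrM; apply: ler_wpM2r => //; exact: Heps.
have bTu : bm (fun y => \sum_(0 <= i < n.+1) (c i * lambda i) * phi i y).
  exact: bm_sum_phi.
(* The left side is <u, T u>, by orthonormality. *)
have main : \sum_(0 <= i < n.+1) lambda i * c i ^+ 2 <= eps * I1 * I1.
  have -> : \sum_(0 <= i < n.+1) lambda i * c i ^+ 2 = 
     \int[mu]_(y in Omega) (u y * \sum_(0 <= i < n.+1) (c i * lambda i) * phi i
       y).
    rewrite Rintegral_sum_phi// !big_nat; apply: eq_bigr => j /andP[_ jn].
    by rewrite fourier_coef_sum jn; ring.
  rewrite -(RintegralZ_bounded mO fO); last exact: bounded_mfun_norm.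
  apply: le_Rintegral => //.
  - by apply: (bounded_mfun_integrable mO fO); exact: bounded_mfunM.
  - apply: (bounded_mfun_integrable mO fO); apply: bounded_mfunZ => //.
    exact: bounded_mfun_norm.
  - move=> y Oy; apply: le_trans (ler_norm _) _; rewrite normrM mulrC.
    apply: ler_wpM2r => //; have := Tu y Oy.
    by under eq_bigr do rewrite mulrA.
have I1S : I1 ^+ 2 <= fine (mu Omega) * S.
  by rewrite -Iuu; exact: (Rintegral_norm_sqr_le mO fO).
rewrite -(ler_pM2r S0) -mulrA; apply: le_trans (_ : eps * I1 * I1 <= _).
  apply: le_trans main; rewrite /S mulr_sumr; rewrite !big_nat.
  apply: ler_sum => i /andP[_ ilt]; apply: ler_wpM2r; first exact: sqr_ge0.
  exact: (mercer_nonincreasing eig).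
by rewrite -mulrA; apply: ler_wpM2l.
Qed.

End mercer.

(** * Decay of the eigenvalues *)

Section grid.
Context {R : realType} {d : nat}.
Local Notation E := 'rV[R]_d.

(** Half-open cubes of side h = 2B/N tile [-B, B)^d, with lower corners [c t]. The cube of x is read
    off from the integer parts of (x_i + B) / h, which the strict bound |x_i| < B keeps below N. *)
Lemma grid_partition (D : set E) (B : R) (N : nat) : 0 < B -> (0 < N)%N ->
  (forall x, D x -> forall i, `|x ord0 i| < B) ->
  exists (Q : {ffun 'I_d -> 'I_N} -> set E) (c : {ffun 'I_d -> 'I_N} -> E),
  [/\ forall t, measurable (Q t),
      forall x, D x -> \sum_t \1_(Q t) x = 1 :> R &
      forall t x, Q t x -> forall i, `|x ord0 i - c t ord0 i| <= 2 * B / N%:R].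
Proof.
move=> B0 N0 DB; pose h : R := 2 * B / N%:R.
have N0R : 0 < N%:R :> R by rewrite ltr0n.
have h0 : 0 < h by rewrite divr_gt0// mulr_gt0.
exists (fun t : {ffun 'I_d -> 'I_N} => [set x : E | forall i,
  - B + (t i : nat)%:R * h <= x ord0 i < - B + (t i : nat).+1%:R * h]).
exists (fun t : {ffun 'I_d -> 'I_N} => \row_i (- B + (t i : nat)%:R * h)).
have QE (t : nat) (s : R) : (- B + t%:R * h <= s < - B + t.+1%:R * h) =
    (t%:R <= (s + B) / h < t.+1%:R).
  by rewrite ler_pdivlMr// ltr_pdivrMr// !(addrC (- B)) lerBlDr ltrBrDr.
split.
- move=> t; set Q : set E := [set x | _].
  rewrite (_ : Q = \bigcap_(i in [set: 'I_d]) (fun x : E => x ord0 i) @^-1`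
     `[- B + (t i : nat)%:R * h, - B + (t i : nat).+1%:R * h[%classic).
    apply: fin_bigcap_measurable => // i _.
    by rewrite -[X in measurable X]setTI; exact: measurable_coord.
  rewrite predeqE => x; split => [H i _|H i]; first by rewrite /= in_itv/= H.
  by have := H i I; rewrite /= in_itv.
- move=> x Dx.
  have q0 i : 0 <= (x ord0 i + B) / h.
    rewrite divr_ge0 ?(ltW h0)// -lerBlDr sub0r.
    by have := ltW (DB _ Dx i); rewrite ler_norml => /andP[].
  have qN i : (Num.truncn ((x ord0 i + B) / h) < N)%N.
    rewrite -(ltr_nat R); apply: le_lt_trans (_ : (x ord0 i + B) / h < _).
      by have := truncn_itv (q0 i) => /andP[].
    rewrite ltr_pdivrMr// /h [N%:R * _]mulrC divfK ?gt_eqF// mulr_natl mulr2n.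
    by rewrite ltrD2r; have := DB _ Dx i; rewrite ltr_norml => /andP[].
  pose t0 : {ffun 'I_d -> 'I_N} := [ffun i => Ordinal (qN i)].
  have Qt0 i : - B + (t0 i : nat)%:R * h <= x ord0 i < - B + (t0 i : nat).+1%:R
    * h.
    by rewrite QE// ffunE/=; exact: truncn_itv.
  rewrite (bigD1 t0)//= indicE mem_set//= big1 ?addr0// => t tt0.
  rewrite indicE memNset//= => Qt; move/eqP: tt0; apply.
  apply/ffunP => i; apply/val_inj => /=.
  have := Qt0 i; rewrite QE// => /andP[a1 a2].
  have := Qt i; rewrite QE// => /andP[b1 b2].
  have := le_lt_trans a1 b2; have := le_lt_trans b1 a2.
  by rewrite !ltr_nat !ltnS => u1 u2; apply/eqP; rewrite eqn_leq u1 u2.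
- move=> t x Qt i; rewrite mxE; have /andP[h1 h2] := Qt i.
  rewrite ger0_norm ?subr_ge0// lerBlDl -/h; apply: ltW;
    apply: lt_le_trans h2 _.
  by rewrite -natr1 mulrDl mul1r addrA.
Qed.

End grid.

(** * Finite-rank approximation of the Matern kernel *)

Section matern_low_rank.
Context {R : realType} {d : nat}.
Local Notation E := 'rV[R]_d.
Implicit Types (x y c u w : E).

Lemma norm2_ge0 x : 0 <= norm2 x. Proof. exact: sqrtr_ge0. Qed.

Lemma norm2_sqr x : norm2 x ^+ 2 = \sum_(i < d) x ord0 i ^+ 2.
Proof. by rewrite sqr_sqrtr// sumr_ge0// => i _; exact: sqr_ge0. Qed.

Lemma coord_le_norm2 x i : `|x ord0 i| <= norm2 x.
Proof.
rewrite -ler_sqr ?nnegrE ?norm2_ge0// norm2_sqr real_normK ?num_real//.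
by rewrite (bigD1 i)//= lerDl sumr_ge0// => j _; exact: sqr_ge0.
Qed.

Lemma norm2N x : norm2 (- x) = norm2 x.
Proof. by rewrite /norm2; under eq_bigr do rewrite mxE sqrrN. Qed.

(** The bracket is the increment v of [matern_local_approx] for z = |c - y|: a polynomial in x - c
    whose coefficients depend on y. *)
Lemma norm2_shift x y c :
  norm2 (y - x) ^+ 2 = norm2 (c - y) ^+ 2 +
   (\sum_(i < d) 2 * (c - y) ord0 i * (x - c) ord0 i + norm2 (x - c) ^+ 2).
Proof.
rewrite !norm2_sqr -!big_split/=; apply: eq_bigr => i _; rewrite !mxE; ring.
Qed.

(* A polynomial of degree less than [k] in
   [v = sum_i 2 w_i u_i + |u|^2] is a combination of products of [k] factors,
   each of which is [1], [|u|^2] or a coordinate of [u]. *)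
Let mono (o : bool + 'I_d) u : R :=
  match o with
  | inl b => if b then 1 else norm2 u ^+ 2
  | inr i => u ord0 i
  end.

(** Chosen so that the sum of [coeff w used o * mono o u] over [o] is v if [used] holds and 1
    otherwise. *)
Let coeff w (used : bool) (o : bool + 'I_d) : R :=
  match o with
  | inl b => (used (+) b)%:R
  | inr i => if used then 2 * w ord0 i else 0
  end.

(** v^m is padded with factors 1 to a product of exactly k factors, so that distributing the product
    uses the same index set for every m. *)
Let polynomial_low_rank (k : nat) (a : nat -> R) w :
  exists alpha : {ffun 'I_k -> bool + 'I_d} -> R, forall u,
    \sum_(m < k) a m *
      (\sum_(i < d) 2 * w ord0 i * u ord0 i + norm2 u ^+ 2) ^+ m =
    \sum_p alpha p * \prod_(j < k) mono (p j) u.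
Proof.
exists (fun p => \sum_(m < k) a m * \prod_(j < k) coeff w (j < m)%N (p j)) => u.
under [RHS]eq_bigr do rewrite mulr_suml.
rewrite exchange_big/=; apply: eq_bigr => m _.
under [RHS]eq_bigr => p _ do rewrite -mulrA -big_split/=.
rewrite -mulr_sumr; congr (_ * _).
rewrite -(bigA_distr_bigA (fun (j : 'I_k) o => coeff w (j < m)%N o * mono o u)).
have -> (v : R) : v ^+ m = \prod_(j < k) (if (j < m)%N then v else 1).
  rewrite -big_mkcond/= -(big_ord_widen k (fun=> v)) ?prodr_const ?card_ord//.
  exact: ltnW.
apply: eq_bigr => j _; rewrite big_sumType/= big_bool/=.
case: ifP => jm; rewrite /= ?mul0r ?mul1r ?addr0 ?add0r.
  by rewrite addrC.
by rewrite big1 ?addr0// => i _; rewrite mul0r.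
Qed.

Variables (nu : R) (B : R) (D : set E).
Hypotheses (nu0 : 0 < nu) (B0 : 0 < B) (d0 : (0 < d)%N).
Hypothesis DB : forall x, D x -> forall i, `|x ord0 i| < B.

Lemma matern_kernel_low_rank : exists2 M : nat, (0 < M)%N &
  exists2 C : R, 0 < C & forall N : nat, (0 < N)%N ->
  exists (J : finType) (beta alpha : J -> E -> R),
  [/\ (#|J| = N ^ d * M)%N, forall p, bounded_mfun D (beta p) &
    forall x y, D x -> D y ->
      `|matern_kernel nu y x - \sum_p alpha p y * beta p x|
        <= C * N%:R `^ (- (2 * nu))].
Proof.
have [k [C C0 HC]] := matern_local_approx nu0.
pose J0 := {ffun 'I_k -> (bool + 'I_d)%type}.
(* The number of products attached to each cube. *)
exists #|{: J0}|.
  by apply/card_gt0P; exists [ffun=> inl true].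
pose A : R := d%:R * (2 * B).
have A0 : 0 < A by rewrite !mulr_gt0// ltr0n.
exists (C * A `^ (2 * nu)); first by rewrite mulr_gt0// powR_gt0.
move=> N N0; have N0R : 0 < N%:R :> R by rewrite ltr0n.
have [Q [c [mQ Q1 Qc]]] := grid_partition B0 N0 DB.
(* This is d times the side of the cubes: the linear part of v is at most 2 z d (2B/N), and |u|^2 <=
   d (2B/N)^2 <= h^2. *)
pose h : R := d%:R * (2 * B / N%:R).
have h0 : 0 < h by rewrite mulr_gt0 ?ltr0n// divr_gt0// mulr_gt0.
have hE : C * A `^ (2 * nu) * N%:R `^ (- (2 * nu)) = C * h `^ (2 * nu).
  rewrite powRN -mulrA; congr (_ * _).
  have -> : h = A / N%:R by rewrite /h /A mulrA.
  rewrite powRM ?(ltW A0) ?invr_ge0 ?(ltW N0R)//; congr (_ * _).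
  by rewrite -[N%:R^-1]powR_inv1 ?(ltW N0R)// -powRrM mulN1r powRN.
(* Choice is over all reals; the zero sequence is a default for negative z, which is no distance. *)
have /choice[a Ha] (z : R) : exists a : nat -> R, 0 <= z ->
    forall r v, 0 <= r -> r ^+ 2 = z ^+ 2 + v -> `|v| <= 2 * z * h + h ^+ 2 ->
    `|matern nu r - \sum_(m < k) a m * v ^+ m| <= C * h `^ (2 * nu).
  have [z0|z0] := leP 0 z; last by exists (fun=> 0).
  by have [a Ha] := HC h z h0 z0; exists a.
have /choice[al Hal] (w : E) := polynomial_low_rank k (a (norm2 w)) w.
pose J := ({ffun 'I_d -> 'I_N} * J0)%type.
exists J; exists (fun (p : J) x => \1_(Q p.1) x * \prod_(j < k) mono (p.2 j) (x
  - c p.1)).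
(* The vertex is determined by the cube index, so y enters through the coefficients only, and x
   through the indicator and the products. *)
exists (fun (p : J) y => al (c p.1 - y) p.2); split.
- by rewrite card_prod card_ffun !card_ord.
- move=> p; have bi : bounded_mfun D (fun x : E => \1_(Q p.1) x : R).
    split; first by apply: measurable_indic.
    by exists 1 => x _; rewrite indicE; case: (_ \in _);
      rewrite ?normr1 ?normr0.
  have bc i : bounded_mfun D (fun x : E => (x - c p.1) ord0 i).
    split.
      apply: measurable_funTS.
      under eq_fun do rewrite !mxE.
      by apply: measurable_funB => //; exact: measurable_coord.
    exists (B + `|c p.1 ord0 i|) => x Dx; rewrite !mxE.
    by apply: le_trans (ler_normB _ _) _; rewrite lerD2r ltW// DB.
  apply: bounded_mfunM => //; apply: bounded_mfun_prod => j _.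
  case: (p.2 j) => [[]|i] /=; [exact: bounded_mfun_cst| |exact: bc].
  under eq_fun do rewrite norm2_sqr.
  by apply: bounded_mfun_sum => i _; apply: bounded_mfunX; exact: bc.
move=> x y Dx Dy; rewrite hE.
have Qle t : Q t x -> `|matern_kernel nu y x -
   \sum_p al (c t - y) p * \prod_(j < k) mono (p j) (x - c t)| <= C * h `^ (2 *
     nu).
  move=> Qt; rewrite -Hal; apply: Ha; [exact: norm2_ge0|exact: norm2_ge0| |].
    exact: norm2_shift.
  set w := c t - y; set u := x - c t.
  have dlt : 0 <= 2 * B / N%:R :> R by rewrite divr_ge0// ?mulr_ge0// ltW.
  have ui i : `|u ord0 i| <= 2 * B / N%:R by rewrite !mxE; exact: Qc.
  apply: le_trans (ler_normD _ _) _; apply: lerD.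
    apply: le_trans (ler_norm_sum _ _ _) _.
    apply: (@le_trans _ _ (\sum_(i < d) 2 * norm2 w * (2 * B / N%:R))).
      apply: ler_sum => i _; rewrite !normrM ger0_norm//.
      by apply: ler_pM => //; rewrite ler_pM2l// coord_le_norm2.
    rewrite sumr_const card_ord -mulr_natl /h le_eqVlt; apply/orP; left.
    by apply/eqP; ring.
  rewrite norm2_sqr ger0_norm; last by apply: sumr_ge0 => i _; exact: sqr_ge0.
  apply: (@le_trans _ _ (\sum_(i < d) (2 * B / N%:R) ^+ 2)).
    apply: ler_sum => i _; rewrite -real_normK ?num_real//.
    by apply: lerXn2r; rewrite ?nnegrE.
  rewrite sumr_const card_ord /h [leRHS]exprMn -[leLHS]mulr_natl.
  apply: ler_wpM2r; first exact: sqr_ge0.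
  by rewrite -natrX ler_nat -mulnn leq_pmulr.
have -> : \sum_p al (c p.1 - y) p.2 *
    (\1_(Q p.1) x * \prod_(j < k) mono (p.2 j) (x - c p.1)) =
    \sum_t \1_(Q t) x *
      \sum_p al (c t - y) p * \prod_(j < k) mono (p j) (x - c t).
  rewrite -(pair_bigA _ (fun t p => al (c t - y) p *
    (\1_(Q t) x * \prod_(j < k) mono (p j) (x - c t))))/=.
  by apply: eq_bigr => t _; rewrite mulr_sumr; apply: eq_bigr => p _; ring.
(* Since the indicators sum to 1 at x, the error can be estimated cube by cube. *)
have cst1 (b : R) : b = \sum_t \1_(Q t) x * b by rewrite -mulr_suml Q1// mul1r.
rewrite [X in `|X - _|]cst1 -sumrB; under eq_bigr do rewrite -mulrBr.
apply: le_trans (ler_norm_sum _ _ _) _.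
rewrite [leRHS]cst1; apply: ler_sum => t _.
rewrite indicE; case: (boolP (x \in Q t)) => [/set_mem Qt|_];
  last by rewrite !mul0r normr0.
by rewrite !mul1r; exact: Qle.
Qed.

End matern_low_rank.

(** * From rank to decay rate *)

Section eigenvalue_decay.
Context {R : realType} {d : nat}.
Local Notation E := 'rV[R]_d.
Local Notation mu := (lebesgue_rV R d).
Variables (Omega : set E) (nu : R) (lambda : nat -> R) (phi : nat -> E -> R).
Hypotheses (cO : compact Omega) (pO : (0 < mu Omega)%E) (nu0 : 0 < nu)
  (d0 : (0 < d)%N).
Hypothesis eig : mercer_system Omega (matern_kernel nu) lambda phi.

Lemma matern_kernel_diag (x : E) : matern_kernel nu x x = 1.
Proof.
rewrite /matern_kernel subrr /matern (_ : norm2 0 = 0) ?eqxx//.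
by rewrite /norm2 big1 ?sqrtr0// => i _; rewrite mxE expr0n.
Qed.

Lemma eigenvalue_decay : exists2 C : R, 0 < C &
  forall n, (0 < n)%N -> lambda n <= C * n%:R `^ (- (2 * nu / d%:R)).
Proof.
have mO := compact_measurable_rV cO; have fO := compact_finite_measure_rV cO.
have [B B0 OB] := compact_box cO.
have [M M0 [C C0 HC]] := matern_kernel_low_rank nu0 B0 d0 OB.
have M0R : 0 < M%:R :> R by rewrite ltr0n.
pose V := fine (mu Omega); have V0 : 0 < V by rewrite fine_gt0// pO.
have bound N n : (0 < N)%N -> (N ^ d * M <= n)%N ->
    lambda n <= C * N%:R `^ (- (2 * nu)) * V.
  move=> N0 Nn; have [J [beta [alpha [cJ bb Hab]]]] := HC _ N0.
  apply: (eigenvalue_low_rank mO fO pO cO eig _ _ bb) Hab.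
  - by move=> x _; exact: matern_kernel_diag.
  - by rewrite cJ.
  - by rewrite mulr_ge0 ?powR_ge0// ltW.
pose e := 2 * nu / d%:R.
have d0R : 0 < d%:R :> R by rewrite ltr0n.
have e0 : 0 < e by rewrite divr_gt0// mulr_gt0.
have l0 := mercer_gt0 eig 0.
(* The first term serves n < M, where a single cube already exceeds the rank and lambda_0 is the
   bound. The second comes from the largest N with N^d M <= n, for which n < (N+1)^d M <= (2N)^d
   M. *)
exists (lambda 0 * M%:R `^ e + C * V * 2 `^ (2 * nu) * M%:R `^ e).
  by rewrite addr_gt0// !mulr_gt0// powR_gt0.
move=> n n0; have n0R : 0 < n%:R :> R by rewrite ltr0n.
rewrite -/e mulrDl.
have P1 : 0 <= lambda 0 * M%:R `^ e * n%:R `^ (- e).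
  by rewrite !mulr_ge0 ?powR_ge0// ltW.
have P2 : 0 <= C * V * 2 `^ (2 * nu) * M%:R `^ e * n%:R `^ (- e).
  by rewrite !mulr_ge0 ?powR_ge0// ltW.
have [nM|Mn] := ltnP n M.
  apply: le_trans (_ : lambda 0 * M%:R `^ e * n%:R `^ (- e) <= _);
    last by rewrite lerDl.
  apply: le_trans (mercer_nonincreasing eig (leq0n n)) _.
  rewrite -mulrA ler_peMr ?(ltW l0)// powRN ler_pdivlMr ?powR_gt0// mul1r.
  by rewrite ge0_ler_powR ?nnegrE ?ler0n ?ler_nat 1?ltnW// ltW.
apply: le_trans (_ : C * V * 2 `^ (2 * nu) * M%:R `^ e * n%:R `^ (- e) <= _);
  last by rewrite lerDr.
have exN : exists N, (N ^ d * M <= n)%N by exists 1%N; rewrite exp1n mul1n.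
have ubN N : (N ^ d * M <= n)%N -> (N <= n)%N.
  move=> H; apply: leq_trans H; case: N => // N.
  apply: leq_trans (leq_pmulr _ M0).
  by rewrite -{1}[N.+1]expn1 leq_pexp2l.
case: (ex_maxnP exN ubN) => N NM maxN.
have N0 : (0 < N)%N by apply: maxN; rewrite exp1n mul1n.
have N0R : 0 < N%:R :> R by rewrite ltr0n.
have nN : (n < N.+1 ^ d * M)%N by rewrite ltnNge; apply/negP => /maxN;
  rewrite ltnn.
apply: le_trans (bound N n N0 NM) _.
have -> : C * V * 2 `^ (2 * nu) * M%:R `^ e * n%:R `^ (- e) =
    C * (2 `^ (2 * nu) * M%:R `^ e * n%:R `^ (- e)) * V by ring.
rewrite ler_pM2r// ler_pM2l//.
rewrite !powRN ler_pdivlMr ?powR_gt0// mulrC ler_pdivrMr ?powR_gt0//.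
have n2 : n%:R <= (2 * N%:R) `^ d%:R * M%:R :> R.
  rewrite powR_mulrn ?mulr_ge0// -natrM -natrX -natrM ler_nat.
  apply: leq_trans (ltnW nN) _; rewrite leq_pmul2r// leq_exp2r// mul2n -addnn.
  by rewrite -addn1 leq_add2l.
apply: le_trans (_ : ((2 * N%:R) `^ d%:R * M%:R) `^ e <= _).
  by rewrite ge0_ler_powR ?nnegrE ?mulr_ge0 ?powR_ge0// ltW.
rewrite powRM ?powR_ge0 ?ler0n// -powRrM (_ : d%:R * e = 2 * nu); last first.
  by rewrite /e mulrCA mulfV ?mulr1 ?gt_eqF.
by rewrite powRM// mulrAC.
Qed.

End eigenvalue_decay.

(** * Conditional expectation and mean square error *)

Section conditional_expectation.
Context {disp} {T : measurableType disp} {R : realType} (P : probability T R).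
Variables (n : nat) (Y : 'I_n -> T -> R).
Hypothesis mY : forall j, measurable_fun setT (Y j).
Local Notation G := (g_sigma_preimage Y).
(** [T] with the sigma-algebra generated by [Y], so that measurability with respect to [G] is an
    instance of [measurable_fun]. *)
Local Notation TY := (g_sigma_algebraType
  (\big[setU/set0]_(i < n) preimage_set_system setT (Y i) measurable)).

Let G_measurable (A : set T) : G A -> measurable A.
Proof.
apply: smallest_sub; first exact: sigma_algebra_measurable.
rewrite -bigcup_seq => B [i _] [C mC <-]; exact: mY.
Qed.

Let G_fun (f : T -> R) : (forall B, measurable B -> G (f @^-1` B)) <->
  measurable_fun [set: TY] (f : TY -> R).
Proof.
split => [H _ B mB|H B mB]; first by rewrite setTI; exact: H.
by have := H measurableT B mB; rewrite setTI.
Qed.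

Let G_Y j : measurable_fun [set: TY] (Y j : TY -> R).
Proof.
apply/G_fun => B mB; apply: sub_sigma_algebra.
rewrite -bigcup_seq/=; exists j => /=; first by rewrite mem_index_enum.
by exists B => //; rewrite setTI.
Qed.

Let integrable_prod_bounded (D U : T -> R) (M : R) :
  P.-integrable setT (EFin \o D) -> measurable_fun setT U ->
  (forall w, `|U w| <= M) -> P.-integrable setT (EFin \o (fun w => D w * U w)).
Proof.
move=> iD mU UM.
have mD : measurable_fun setT D by apply/measurable_EFinP;
  exact: measurable_int iD.
apply: (@le_integrable _ _ _ P setT measurableT _ (fun w => M%:E * (EFin \o D)
  w)%E).
- by apply/measurable_EFinP; exact: measurable_funM.
- move=> w _; rewrite /= lee_fin !normrM mulrC; apply: ler_wpM2r => //.
  exact: le_trans (UM _) (ler_norm _).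
- exact: integrableZl.
Qed.

(* A bounded function is approximated uniformly by [k^-1] times the number of
   levels [(i + 1) / k] that it reaches. *)
Let orthogonal_ge0 (D U : T -> R) (L : nat) :
  P.-integrable setT (EFin \o D) ->
  (forall A, G A -> \int[P]_(w in A) D w = 0) ->
  measurable_fun [set: TY] (U : TY -> R) -> (forall w, 0 <= U w <= L%:R) ->
  \int[P]_w (D w * U w) = 0.
Proof.
move=> iD D0 mU UL.
have mUT : measurable_fun [set: T] U.
  move=> _ B mB; rewrite setTI; apply: G_measurable.
  by have := mU measurableT B mB; rewrite setTI.
pose A k i : set T := U @^-1` `[i.+1%:R / k.+1%:R, +oo[.
have GA k i : G (A k i).
  by have := mU measurableT `[i.+1%:R / k.+1%:R, +oo[%classic; rewrite setTI;
    apply.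
have mA k i : measurable (A k i) by exact: G_measurable.
pose V k w : R := \sum_(i < (L * k.+1)%N) k.+1%:R^-1 * \1_(A k i) w.
have k0 k : 0 < k.+1%:R :> R by rewrite ltr0n.
have VU k w : `|U w - V k w| <= k.+1%:R^-1.
  have /andP[U0 ULw] := UL w; pose t := U w * k.+1%:R.
  have t0 : 0 <= t by rewrite mulr_ge0// ltW.
  have tL : (Num.truncn t <= L * k.+1)%N.
    rewrite -(ler_nat R); apply: le_trans (_ : t <= _);
      first by rewrite truncn_le.
    by rewrite natrM ler_pM2r.
  have -> : V k w = k.+1%:R^-1 * (Num.truncn t)%:R.
    rewrite /V -mulr_sumr; congr (_ * _).
    transitivity (\sum_(i < (L * k.+1)%N) (i < Num.truncn t)%N%:R : R).
      apply: eq_bigr => i _; rewrite indicE truncn_gt_nat /t -ler_pdivrMr//.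
      congr (_%:R); congr (nat_of_bool _); apply/idP/idP.
        by move=> /set_mem; rewrite /A/= in_itv/= andbT.
      by move=> H; apply/mem_set; rewrite /A/= in_itv/= andbT.
    rewrite -natr_sum; congr (_%:R); rewrite -[RHS]card_ord -sum1_card.
    rewrite (big_ord_widen _ (fun=> 1%N) tL) [RHS]big_mkcond/=.
    by apply: eq_bigr => i _; case: ltnP.
  have /andP[a1 a2] := truncn_itv t0.
  have -> : U w = k.+1%:R^-1 * t by rewrite /t mulrC mulfK// gt_eqF.
  rewrite -mulrBr normrM ger0_norm ?invr_ge0 ?(ltW (k0 k))//.
  rewrite -[leRHS]mulr1 ler_pM2l ?invr_gt0// ger0_norm ?subr_ge0//.
  by rewrite lerBlDl natr1 ltW.
have mV k : measurable_fun setT (V k).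
  apply: measurable_sum => i; apply: measurable_funM => //.
have iDU : P.-integrable setT (EFin \o (fun w => D w * U w)).
  apply: (integrable_prod_bounded (M := L%:R)) => // w.
  by have /andP[U0 ULw] := UL w; rewrite ger0_norm.
have iA k i : P.-integrable setT (EFin \o (fun w => D w * \1_(A k i) w)).
  apply: (integrable_prod_bounded (M := 1)) => // w.
  by rewrite indicE; case: (_ \in _); rewrite ?normr1 ?normr0.
have IA k i : \int[P]_w (D w * \1_(A k i) w) = 0.
  rewrite -(D0 _ (GA k i)) [RHS]Rintegral_mkcond; apply: eq_Rintegral => w _.
  by rewrite patchE indicE; case: (_ \in _); rewrite ?mulr1 ?mulr0.
have iDUV k : P.-integrable setT (EFin \o (fun w => D w * (U w - V k w))).
  by apply: (integrable_prod_bounded (M := k.+1%:R^-1)) => //;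
    exact: measurable_funB.
have DVE k w : D w * V k w =
    \sum_(i < (L * k.+1)%N) k.+1%:R^-1 * (D w * \1_(A k i) w).
  by rewrite /V mulr_sumr; apply: eq_bigr => i _; rewrite mulrCA.
have iDV k : P.-integrable setT (EFin \o (fun w => D w * V k w)).
  rewrite (_ : _ \o _ = (fun w => \sum_(i < (L * k.+1)%N) (k.+1%:R^-1)%:E *
      (EFin \o (fun w => D w * \1_(A k i) w)%R) w)%E); last first.
    by apply/funext => w; rewrite /= DVE -sumEFin.
  by apply: integrable_sum => // i _; apply: integrableZl.
have IDV k : \int[P]_w (D w * V k w) = 0.
  rewrite /Rintegral (_ : (\int[P]_w (D w * V k w)%:E)%E = 0%E)//.
  transitivity (\int[P]_w (\sum_(i < (L * k.+1)%N) (k.+1%:R^-1)%:E *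
      (EFin \o (fun w => D w * \1_(A k i) w)%R) w))%E.
    by apply: eq_integral => w _; rewrite /= DVE -sumEFin.
  rewrite integral_sum//; last by move=> i; exact: integrableZl.
  rewrite big1// => i _; rewrite integralZl//.
  rewrite (_ : (\int[P]_w _)%E = 0%E) ?mule0//.
  rewrite -[LHS]fineK; last exact: integrable_fin_num.
  by rewrite -[fine _]/(\int[P]_w (D w * \1_(A k i) w))%R IA.
set J := (\int[P]_w (D w * U w))%R; set I1 := (\int[P]_w `|D w|)%R.
(* The integral of [D * V k] vanishes by linearity, so [U] may be replaced by [U - V k], which is
   uniformly small. *)
have JI k : `|J| <= k.+1%:R^-1 * I1.
  have -> : J = \int[P]_w (D w * (U w - V k w)).
    under eq_Rintegral do rewrite mulrBr.
    by rewrite RintegralB// IDV subr0.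
  apply: le_trans (le_normr_Rintegral _ _) _ => //.
  rewrite -RintegralZl//; last exact: integrable_norm.
  apply: le_Rintegral => //.
  - exact: integrable_norm.
  - have := @integrableZl _ _ _ P setT measurableT k.+1%:R^-1 _
      (integrable_norm iD).
    by apply: eq_integrable.
  - by move=> w _; rewrite normrM mulrC; apply: ler_wpM2r.
apply/eqP; rewrite -normr_eq0 eq_le normr_ge0 andbT.
have I10 : 0 <= I1 by apply: Rintegral_ge0.
apply/ler_addgt0Pl => e e0; rewrite addr0.
have := JI (Num.truncn (I1 / e)); move/le_trans; apply.
by rewrite ler_pdivrMl// mulrC -ler_pdivrMl// mulrC ltW// truncnS_gt.
Qed.

(** A constant makes [U] nonnegative, and contributes nothing because [D] has integral 0 over the
    whole space. *)
Let orthogonal (D U : T -> R) (M : R) :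
  P.-integrable setT (EFin \o D) ->
  (forall A, G A -> \int[P]_(w in A) D w = 0) ->
  measurable_fun [set: TY] (U : TY -> R) -> (forall w, `|U w| <= M) ->
  \int[P]_w (D w * U w) = 0.
Proof.
move=> iD D0 mU UM.
have DT : \int[P]_w D w = 0.
  by apply: D0; exact: (@measurableT _ TY).
have mUT : measurable_fun [set: T] U.
  move=> _ B mB; rewrite setTI; apply: G_measurable.
  by have := mU measurableT B mB; rewrite setTI.
pose L := (Num.truncn M).+1.
have UL w : `|U w| <= L%:R.
  by apply: le_trans (UM w) _; apply: ltW; exact: truncnS_gt.
have := @orthogonal_ge0 D (fun w => U w + L%:R) (L + L) iD D0.
have mUL : measurable_fun [set: TY] (fun w : TY => U w + L%:R).
  exact: measurable_funD.
move=> /(_ mUL) H.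
have : \int[P]_w (D w * (U w + L%:R)) = 0.
  apply: H => w; have := UL w; rewrite ler_norml => /andP[h1 h2].
  by rewrite -lerBlDr sub0r h1/= natrD lerD2r.
under eq_Rintegral do rewrite mulrDr.
have iDU : P.-integrable setT (EFin \o (fun w => D w * U w)).
  exact: (integrable_prod_bounded (M := M)).
have iDL : P.-integrable setT (EFin \o (fun w => D w * L%:R)).
  by apply: (integrable_prod_bounded (M := L%:R)) => // w; rewrite normr_nat.
by rewrite RintegralD// RintegralZr// DT mul0r addr0.
Qed.

(** Pythagoras on the sets [A m] of the sub-sigma-algebra where |Z| and |W| are at most m, then
    monotone convergence. Without truncation the cross term (X - Z)(Z - W) might fail to be
    integrable. *)
Lemma cond_expectation_mse (X Z W : T -> R) : measurable_fun setT X ->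
  P.-integrable setT (EFin \o X) ->
  is_cond_expectation P X Y Z ->
  measurable_fun [set: TY] (W : TY -> R) ->
  P.-integrable setT (EFin \o (fun w => (X w - W w) ^+ 2)) ->
  (\int[P]_w ((X w - Z w) ^+ 2)%:E <= \int[P]_w ((X w - W w) ^+ 2)%:E)%E.
Proof.
move=> mX iX [GZ iZ XZ] mW iXW.
have mZ : measurable_fun [set: TY] (Z : TY -> R) by apply/G_fun.
have toT (U : T -> R) : measurable_fun [set: TY] (U : TY -> R) ->
  measurable_fun [set: T] U.
  move=> mU _ B mB; rewrite setTI; apply: G_measurable.
  by have := mU measurableT B mB; rewrite setTI.
have mZT := toT _ mZ; have mWT := toT _ mW.
pose D w := X w - Z w.
have iD : P.-integrable setT (EFin \o D).
  by have := integrableB measurableT iX iZ; apply: eq_integrable.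
have D0 A : G A -> \int[P]_(w in A) D w = 0.
  move=> GA; have mA := G_measurable GA.
  have iXA : P.-integrable A (EFin \o X) by apply: integrableS iX.
  have iZA : P.-integrable A (EFin \o Z) by apply: integrableS iZ.
  by rewrite RintegralB// /Rintegral XZ// subrr.
pose A (m : nat) : set TY := [set w | Num.max `|Z w| `|W w| <= m%:R].
have mAY m : measurable (A m).
  have mm : measurable_fun [set: TY] (fun w : TY => Num.max `|Z w| `|W w|).
    by apply: measurable_maxr; exact: measurableT_comp.
  have := mm measurableT `]-oo, m%:R]%classic;
    rewrite setTI => /(_ (measurable_itv _)).
  by congr (measurable _); rewrite predeqE => w /=; rewrite in_itv.
have mA m : measurable (A m : set T) by apply: G_measurable; exact: mAY.
have bound m : (\int[P]_(w in A m) ((X w - Z w) ^+ 2)%:E <=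
    \int[P]_w ((X w - W w) ^+ 2)%:E)%E.
  pose U w : R := (Z w - W w) * \1_(A m : set T) w.
  have mU : measurable_fun [set: TY] (U : TY -> R).
    by apply: measurable_funM; [exact: measurable_funB|exact: measurable_indic].
  have UM w : `|U w| <= m%:R + m%:R.
    rewrite /U indicE; case: (boolP (w \in _)) => [/set_mem|_]; last first.
      by rewrite mulr0 normr0 addr_ge0.
    rewrite /A/= ge_max => /andP[h1 h2]; rewrite mulr1.
    by apply: le_trans (ler_normB _ _) _; exact: lerD.
  have iDU : P.-integrable setT (EFin \o (fun w => D w * U w)).
    by apply: (integrable_prod_bounded (M := m%:R + m%:R)) => //; exact: toT.
  have IDU : \int[P]_w (D w * U w) = 0 by exact: (orthogonal (M := m%:R +
    m%:R)).
  have i2 : P.-integrable setT (EFin \o (fun w => - 2 * (D w * U w))).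
    by have := @integrableZl _ _ _ P setT measurableT (- 2) _ iDU;
      apply: eq_integrable.
  have i3 : P.-integrable setT (EFin \o (fun w => (X w - W w) ^+ 2 + - 2 * (D w
    * U w))).
    by have := integrableD measurableT iXW i2; apply: eq_integrable.
  rewrite integral_mkcond.
  apply: (@le_trans _ _ (\int[P]_w ((X w - W w) ^+ 2 + - 2 * (D w * U
    w))%R%:E)%E).
    apply: ge0_le_integral => //=.
    - move=> w _; rewrite patchE; case: ifP => // _.
      by rewrite lee_fin sqr_ge0.
    - apply: (measurable_restrictT _ (mA m)).1; apply/measurable_EFinP.
      apply: measurable_funTS; apply: measurable_funX; exact: measurable_funB.
    - exact: measurable_int i3.
    (* On [A m], expand (X - W)^2 around Z and drop (Z - W)^2; off [A m], the left side is 0 and so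
       is [U]. *)
    - move=> w _; rewrite patchE /U /D indicE; case: ifP => _.
        rewrite lee_fin mulr1.
        have := sqr_ge0 (Z w - W w); nra.
      by rewrite !mulr0 addr0 lee_fin sqr_ge0.
  rewrite -[leLHS]fineK; last exact: (integrable_fin_num measurableT i3).
  rewrite -[leRHS]fineK; last exact: (integrable_fin_num measurableT iXW).
  rewrite lee_fin -[leLHS]/(\int[P]_w ((X w - W w) ^+ 2 + - 2 * (D w * U w)))%R.
  by rewrite RintegralD// RintegralZl// IDU mulr0 addr0.
have AT : [set: T] = \bigcup_m (A m : set T).
  rewrite predeqE => w; split => //= _.
  exists (Num.truncn (Num.max `|Z w| `|W w|)).+1 => //.
  by rewrite /A/= ltW// truncnS_gt.
have cv : (\int[P]_(w in (A m : set T)) ((X w - Z w) ^+ 2)%:E)%E @[m --> \oo]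
  -->
    (\int[P]_w ((X w - Z w) ^+ 2)%:E)%E.
  rewrite [in X in _ --> X]AT.
  apply: (@ge0_nondecreasing_set_cvg_integral _ T R (fun m => A m : set T)
     (EFin \o (fun w => (X w - Z w) ^+ 2)) P) => //.
  - move=> k m km; apply/subsetPset => w; rewrite /A/= => /le_trans; apply.
    by rewrite ler_nat.
  - move=> m; apply/measurable_EFinP; apply: measurable_funTS.
    apply: measurable_funX; exact: measurable_funB.
  - by move=> m w _; rewrite lee_fin sqr_ge0.
rewrite -(cvg_lim _ cv)//; apply: lime_le; first by apply/cvg_ex; eexists;
  exact: cv.
by near=> m; exact: bound.
Unshelve. all: by end_near. Qed.

Lemma measurable_linear_combination (c : 'I_n -> R) :
  measurable_fun [set: TY] (fun w : TY => \sum_(j < n) c j * Y j w).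
Proof.
apply: measurable_sum => j; apply: measurable_funM => //; exact: G_Y.
Qed.

End conditional_expectation.

(** * Mean square error in terms of covariances *)

Section centered_L2.
Context {disp} {T : measurableType disp} {R : realType} (P : probability T R).
Local Open Scope ereal_scope.

Lemma centered_covariance (X Y : T -> R) : 'E_P[X] = 0 -> 'E_P[Y] = 0 ->
  covariance P X Y = \int[P]_w (X w * Y w)%R%:E.
Proof.
move=> EX EY; rewrite unlock EX EY unlock; apply: eq_integral => w _.
by congr EFin; rewrite -[LHS]/((X w - 0) * (Y w - 0))%R !subr0.
Qed.

Lemma sqr_integrable (X : T -> R) (v : R) : measurable_fun setT X ->
  'E_P[X] = 0 -> covariance P X X = v%:E ->
  P.-integrable setT (EFin \o (fun w => X w ^+ 2)%R).
Proof.
move=> mX EX; rewrite centered_covariance// => H; apply/integrableP; split.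
  by apply/measurable_EFinP; exact: measurable_funX.
under eq_integral => w _ do rewrite /= ger0_norm ?sqr_ge0// expr2.
by rewrite H ltry.
Qed.

Lemma prod_integrable (X Y : T -> R) :
  measurable_fun setT X -> measurable_fun setT Y ->
  P.-integrable setT (EFin \o (fun w => X w ^+ 2)%R) ->
  P.-integrable setT (EFin \o (fun w => Y w ^+ 2)%R) ->
  P.-integrable setT (EFin \o (fun w => X w * Y w)%R).
Proof.
move=> mX mY iX iY.
apply: (le_integrable measurableT _ _ (integrableD measurableT iX iY)).
  by apply/measurable_EFinP; exact: measurable_funM.
move=> w _; rewrite /= lee_fin normrM [leRHS]ger0_norm ?addr_ge0 ?sqr_ge0//.
rewrite -(real_normK (num_real (X w))) -(real_normK (num_real (Y w))).
by have := sqr_ge0 (`|X w| - `|Y w|)%R; have := normr_ge0 (X w);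
  have := normr_ge0 (Y w); nra.
Qed.

(** The right side is E (X - sum_j c_j Y_j)^2 for centred variables, and this combination is a
    competitor [W] in [cond_expectation_mse]. *)
Lemma mse_linear_combination (n : nat) (X : {RV P >-> R}) (Y : 'I_n -> {RV P
  >-> R})
    (Z : T -> R) (c : 'I_n -> R) (kX : R) (kY : 'I_n -> R) (K : 'I_n -> 'I_n ->
      R) :
  'E_P[X] = 0 -> (forall j, 'E_P[Y j] = 0) ->
  covariance P X X = kX%:E -> (forall j, covariance P (Y j) X = (kY j)%:E) ->
  (forall i j, covariance P (Y i) (Y j) = (K i j)%:E) ->
  is_cond_expectation P X (fun j => Y j : T -> R) Z ->
  'E_P[fun w => ((X w - Z w) ^+ 2)%R] <=
    (kX - 2 * (\sum_j c j * kY j) + \sum_i \sum_j c i * c j * K i j)%R%:E.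
Proof.
move=> EX EY cX cYX cYY XZ; rewrite unlock.
have mX : measurable_fun setT X by [].
have mY j : measurable_fun setT (Y j) by [].
have iX := sqr_integrable mX EX cX.
have iY j := sqr_integrable (mY j) (EY j) (cYY j j).
have iYX j := prod_integrable (mY j) mX (iY j) iX.
have iYY i j := prod_integrable (mY i) (mY j) (iY i) (iY j).
(* X is the product of two square-integrable functions, itself and the constant 1. *)
have iX1 : P.-integrable setT (EFin \o X).
  have i1 : P.-integrable setT (EFin \o (fun=> 1%R) : T -> \bar R).
    exact: finite_measure_integrable_cst.
  have := @prod_integrable X (fun=> 1%R) mX (measurable_cst _) iX.
  move=> /(_ _)/(@eq_integrable _ _ _ P setT measurableT); apply.
    by move=> w _; rewrite /= mulr1.
  by apply: eq_integrable i1 => // w _; rewrite /= expr1n.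
pose W w := (\sum_j c j * Y j w)%R.
have expand w : ((X w - W w) ^+ 2 = X w ^+ 2 - \sum_j 2 * c j * (Y j w * X w)
    + \sum_i \sum_j c i * c j * (Y i w * Y j w))%R.
  have -> : (\sum_j 2 * c j * (Y j w * X w) = 2 * (X w * W w))%R.
    by rewrite /W !mulr_sumr; apply: eq_bigr => j _; ring.
  have -> : (\sum_i \sum_j c i * c j * (Y i w * Y j w) = W w ^+ 2)%R.
    rewrite expr2 {1}/W mulr_suml; apply: eq_bigr => i _.
    by rewrite /W mulr_sumr; apply: eq_bigr => j _; ring.
  ring.
have iS1 : P.-integrable setT (EFin \o (fun w => \sum_j 2 * c j * (Y j w * X
  w))%R).
  rewrite (_ : _ \o _ = (fun w => \sum_j (2 * c j)%R%:E *
    (EFin \o (fun w => Y j w * X w)%R) w)); last first.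
    by apply/funext => w; rewrite /= -sumEFin.
  by apply: integrable_sum => // j _; exact: integrableZl.
have iS2 : P.-integrable setT (EFin \o
    (fun w => \sum_i \sum_j c i * c j * (Y i w * Y j w))%R).
  rewrite (_ : _ \o _ = (fun w => \sum_i \sum_j (c i * c j)%R%:E *
    (EFin \o (fun w => Y i w * Y j w)%R) w)); last first.
    apply/funext => w; rewrite /= -sumEFin; apply: eq_bigr => i _.
    by rewrite -sumEFin.
  apply: integrable_sum => // i _; apply: integrable_sum => // j _.
  exact: integrableZl.
have iXS : P.-integrable setT (EFin \o
    (fun w => X w ^+ 2 - \sum_j 2 * c j * (Y j w * X w))%R).
  by have := integrableB measurableT iX iS1; apply: eq_integrable.
have iXW : P.-integrable setT (EFin \o (fun w => (X w - W w) ^+ 2)%R).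
  have := integrableD measurableT iXS iS2; apply: eq_integrable => // w _.
  by rewrite /= expand.
have fin (U V : T -> R) k : covariance P U V = k%:E -> 'E_P[U] = 0 -> 'E_P[V] =
  0 ->
    (\int[P]_w (U w * V w) = k)%R.
  by move=> H EU EV; rewrite /Rintegral -centered_covariance// H.
have -> : (kX - 2 * (\sum_j c j * kY j) + \sum_i \sum_j c i * c j * K i j)%R%:E
  =
    \int[P]_w ((X w - W w) ^+ 2)%:E.
  rewrite -[RHS]fineK; last exact: (integrable_fin_num measurableT iXW).
  congr EFin; rewrite -[RHS]/(\int[P]_w ((X w - W w) ^+ 2))%R.
  under [RHS]eq_Rintegral do rewrite expand.
  rewrite RintegralD// RintegralB//; congr (_ - _ + _)%R.
  - by under eq_Rintegral do rewrite expr2; rewrite (fin X X kX).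
  - rewrite /Rintegral (_ : \int[P]_w _ =
      \int[P]_w \sum_j (2 * c j)%R%:E * (EFin \o (fun w => Y j w * X w)%R) w);
        last first.
      by apply: eq_integral => w _; rewrite /= -sumEFin.
    rewrite integral_sum//; last by move=> j; exact: integrableZl.
    rewrite -sum_fine; last first.
      by move=> j _; apply: integrable_fin_num => //; exact: integrableZl.
    rewrite mulr_sumr; apply: eq_bigr => j _.
    rewrite integralZl// fineM//; last exact: integrable_fin_num.
    rewrite -[X in _ = (_ * X)%R]/(\int[P]_w (Y j w * X w))%R (fin _ _ (kY
      j))//=.
    by rewrite mulrA.
  - rewrite /Rintegral (_ : \int[P]_w _ =
      \int[P]_w \sum_i \sum_j (c i * c j)%R%:E * (EFin \o (fun w => Y i w * Y j
        w)%R) w);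
      last first.
      by apply: eq_integral => w _; rewrite -sumEFin; apply: eq_bigr => i _;
        rewrite -sumEFin.
    rewrite integral_sum//; last first.
      by move=> i; apply: integrable_sum => // j _; exact: integrableZl.
    rewrite -sum_fine; last first.
      move=> i _; apply: integrable_fin_num => //.
      by apply: integrable_sum => // j _; exact: integrableZl.
    apply: eq_bigr => i _.
    rewrite integral_sum//; last by move=> j; exact: integrableZl.
    rewrite -sum_fine; last first.
      by move=> j _; apply: integrable_fin_num => //; exact: integrableZl.
    apply: eq_bigr => j _.
    rewrite integralZl// fineM//; last exact: integrable_fin_num.
    by rewrite -[X in _ = (_ * X)%R]/(\int[P]_w (Y i w * Y j w))%R (fin _ _ (K
      i j)).
apply: (cond_expectation_mse mY mX iX1 XZ _ iXW).
exact: measurable_linear_combination.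
Qed.

End centered_L2.

(** * The native space *)

Section uniform_continuity.
Context {R : realType} {d : nat}.
Local Notation E := 'rV[R]_d.

(** The near-covering form of compactness, with the modulus [del] as the parameter tending to 0 from
    the right. *)
Lemma compact_uniformly_continuous (K : set E) (f : E -> R) :
  compact K -> {within K, continuous f} -> forall e : R, 0 < e ->
  exists2 del : R, 0 < del & forall x y, K x -> K y ->
    (forall i, `|x ord0 i - y ord0 i| < del) -> `|f x - f y| <= e.
Proof.
move=> cK /subspace_continuousP cf e e0.
have /near_covering_withinP/(_ R (0^'+)%R
    (fun del x => forall y, K y -> (forall i, `|x ord0 i - y ord0 i| < del) ->
      `|f x - f y| <= e)) := (compact_near_coveringP _).1 cK.
case.
- move=> x Kx; have /cvgrPdist_lt/(_ _ (divr_gt0 e0 (ltr0n R 2))) := cf _ Kx.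
  rewrite /within/= => /nbhs_ballP[r /= r0 Hr].
  have r20 : 0 < r / 2 by rewrite divr_gt0.
  have near_x (y : E) : K y -> (forall i, `|x ord0 i - y ord0 i| < r) ->
      `|f x - f y| < e / 2.
    by move=> Ky xy; apply: Hr => //; apply/ball_rVP.
  exists (ball x (r / 2), [set del | del < r / 2]) => /=.
    split; first exact: nbhsx_ballx.
    by apply: nbhs_right_lt.
  move=> [y del]/= [/(ball_rVP _ _ r20) xy dr] Ky z Kz yz.
  rewrite -(subrK (f x) (f y)) -addrA; apply: le_trans (ler_normD _ _) _.
  have -> : e = e / 2 + e / 2 by lra.
  apply: lerD; apply: ltW.
    rewrite distrC; apply: near_x => // i.
    by apply: lt_le_trans (xy i) _; rewrite ler_pdivrMr// ler_peMr ?ler1n ?ltW.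
  apply: near_x => // i.
  apply: le_lt_trans (ler_distD (y ord0 i) _ _) _.
  have := xy i; have := yz i; lra.
- move=> del del0 Hd; have [del' d1 d2] : exists2 del' : R, 0 < del' & del' <
    del.
    by exists (del / 2); [rewrite divr_gt0|rewrite ltr_pdivrMr// ltr_pMr//
      ltr1n].
  exists del' => // x y Kx Ky xy; apply: Hd Kx _ Ky xy => //=.
  by rewrite sub0r normrN gtr0_norm.
Qed.

End uniform_continuity.

Section matern_continuity.
Context {R : realType}.

(** [matern_local_approx] at z = 0 puts the function within C h^(2 nu) of a continuous polynomial in
    r^2 for r < h; h is chosen to make this e / 4. *)
Lemma matern_near0 (nu : R) : 0 < nu -> forall e : R, 0 < e ->
  exists2 del : R, 0 < del & forall r, 0 <= r < del -> 1 - matern nu r <= e.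
Proof.
move=> nu0 e e0; have [k [C C0 HC]] := matern_local_approx nu0.
pose h := (e / (4 * C)) `^ (2 * nu)^-1.
have q0 : 0 < e / (4 * C) by rewrite divr_gt0// mulr_gt0.
have h0 : 0 < h by rewrite powR_gt0.
have hE : C * h `^ (2 * nu) = e / 4.
  rewrite /h -powRrM mulVf ?gt_eqF ?mulr_gt0// powRr1 ?ltW//.
  by field; rewrite gt_eqF.
have [a Ha] := HC h 0 h0 (lexx 0).
pose p r := \sum_(m < k) a m * (r ^+ 2) ^+ m : R.
have cp : continuous p.
  have -> : p = horner (\poly_(m < k) a m) \o (fun r => r ^+ 2).
    by apply/funext => r; rewrite /= horner_poly.
  by move=> r; apply: continuous_comp;
    [exact: exprn_continuous|exact: continuous_horner].
have /cvgrPdist_lt/(_ (e / 4)) := cp 0.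
rewrite divr_gt0// => /(_ isT)/nbhs_ballP[s /= s0 Hs].
exists (Num.min h s); first by rewrite lt_min h0.
move=> r /andP[r0]; rewrite lt_min => /andP[rh rs].
have b1 : `|matern nu r - p r| <= e / 4.
  rewrite -hE; apply: Ha => //; first by rewrite expr0n add0r.
  rewrite mulr0 mul0r add0r ger0_norm ?sqr_ge0//.
  by rewrite lerXn2r ?nnegrE// ltW.
have b0 : `|1 - p 0| <= e / 4.
  have m0 : matern nu 0 = 1 by rewrite /matern eqxx.
  rewrite -hE -[X in `|X - _|]m0.
  apply: Ha => //; first by rewrite expr0n add0r.
  by rewrite expr0n/= normr0 mulr0 mul0r add0r sqr_ge0.
have b2 : `|p 0 - p r| < e / 4.
  by apply: Hs; rewrite /ball/= sub0r normrN ger0_norm.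
move: b0 b1 b2; rewrite !ler_norml ltr_norml.
by move=> /andP[? ?] /andP[? ?] /andP[? ?]; lra.
Qed.

End matern_continuity.

(** * Cauchy-Schwarz in a reproducing kernel space *)

Section rkhs_theory.
Context {R : realType} {X : Type} (k : X -> X -> R) (N : rkhs k).
Local Notation dot := (rkhs_dot N).
Local Notation H := (rkhs_carrier N).
Implicit Types (g h u : X -> R).

Definition kernel_comb (l : seq (R * X)) : X -> R :=
  foldr (fun p h => p.1 *: k ^~ p.2 + h) 0 l.

Lemma kernel_combE l x : kernel_comb l x = \sum_(p <- l) p.1 * k x p.2.
Proof.
by elim: l => [|p l IH]; rewrite ?big_nil// big_cons -IH.
Qed.

Lemma rkhs_carrier0 g : H g -> H 0.
Proof.
move=> Hg; have := rkhs_lin (-1) Hg Hg.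
by rewrite scaleN1r addNr.
Qed.

Lemma rkhs_dot0l g u : H g -> H u -> dot 0 u = 0.
Proof.
move=> Hg Hu; have H0 := rkhs_carrier0 Hg; have := rkhs_dotDl 1 H0 H0 Hu.
rewrite scale1r addr0 mul1r => e; apply: (addrI (dot 0 u)).
by rewrite -e addr0.
Qed.

Lemma rkhs_dot_ge0 g : H g -> 0 <= dot g g.
Proof.
move=> Hg; have [->|/eqP g0] := eqVneq g 0; first by rewrite (rkhs_dot0l Hg)//;
  exact: rkhs_carrier0 Hg.
exact/ltW/rkhs_dot_gt0.
Qed.

Lemma kernel_comb_carrier g l : H g -> H (kernel_comb l).
Proof.
move=> Hg; elim: l => [|p l IH]; first exact: rkhs_carrier0 Hg.
by apply: rkhs_lin => //; exact: rkhs_kernel.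
Qed.

Lemma dot_kernel_comb g l : H g -> dot (kernel_comb l) g = \sum_(p <- l) p.1 *
  g p.2.
Proof.
move=> Hg; elim: l => [|p l IH]; first by rewrite big_nil (rkhs_dot0l Hg).
have Hk := rkhs_kernel N p.2.
rewrite big_cons -IH /= rkhs_dotDl//; last exact: kernel_comb_carrier Hg.
by rewrite rkhs_dotC// rkhs_reproducing.
Qed.

(** Cauchy-Schwarz for g and [kernel_comb l], with both products evaluated by the reproducing
    property so that only values at points remain. *)
Lemma rkhs_cauchy_schwarz g l : H g ->
  (\sum_(p <- l) p.1 * g p.2) ^+ 2 <=
  dot g g * \sum_(p <- l) p.1 * kernel_comb l p.2.
Proof.
move=> Hg; have Hl := kernel_comb_carrier l Hg.
rewrite -dot_kernel_comb// -dot_kernel_comb//.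
set f := kernel_comb l; set a := dot f g; set b := dot g g; set c := dot f f.
have c0 : 0 <= c by exact: rkhs_dot_ge0.
have b0 : 0 <= b by exact: rkhs_dot_ge0.
(* The squared norm of t f + g. *)
have Q (t : R) : 0 <= t ^+ 2 * c + 2 * t * a + b.
  have Hh := rkhs_lin t Hl Hg; have := rkhs_dot_ge0 Hh.
  rewrite rkhs_dotDl// (rkhs_dotC Hl Hh) (rkhs_dotC Hg Hh) !rkhs_dotDl//.
  by rewrite (rkhs_dotC Hg Hl) -/a -/b -/c; congr (0 <= _); ring.
have [c00|cn0] := eqVneq c 0.
  have [->|an0] := eqVneq a 0; first by rewrite expr0n/= mulr_ge0.
  (* With c = 0 the form is affine in t, and takes the value -1 here. *)
  have := Q (- (b + 1) / (2 * a)); rewrite c00 mulr0 add0r.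
  have -> : 2 * (- (b + 1) / (2 * a)) * a = - (b + 1) by field.
  lra.
have cp : 0 < c by rewrite lt_def cn0.
have := Q (- a / c).
have -> : (- a / c) ^+ 2 * c + 2 * (- a / c) * a + b = (b * c - a ^+ 2) / c by
  field.
by rewrite pmulr_lge0 ?invr_gt0// subr_ge0.
Qed.

Lemma kernel_sqr_le x y : k x y ^+ 2 <= k y y * k x x.
Proof.
have := rkhs_cauchy_schwarz [:: (1, x)] (rkhs_kernel N y).
rewrite rkhs_reproducing; last exact: rkhs_kernel.
by rewrite !big_seq1 kernel_combE big_seq1 /= !mul1r.
Qed.

(** Cauchy-Schwarz for the section at y and the difference of the sections at x and x'. *)
Lemma kernel_dist_sqr_le x x' y :
  (k x y - k x' y) ^+ 2 <= k y y * (k x x - k x x' - k x' x + k x' x').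
Proof.
have := rkhs_cauchy_schwarz [:: (1, x); (-1, x')] (rkhs_kernel N y).
rewrite rkhs_reproducing; last exact: rkhs_kernel.
rewrite 2!big_cons big_nil 2!big_cons big_nil !kernel_combE.
rewrite 2!big_cons big_nil 2!big_cons big_nil /= => H.
have -> : k x y - k x' y = 1 * k x y + (-1 * k x' y + 0) by ring.
by apply: le_trans H _; rewrite le_eqVlt; apply/orP; left; apply/eqP; ring.
Qed.

End rkhs_theory.

Section quadrature.
Context {R : realType} {d : nat}.
Local Notation E := 'rV[R]_d.
Local Notation mu := (lebesgue_rV R d).

(** Nodes and weights are fixed before the integrand, so that one rule serves all the integrals and
    both sums of the double sum in [rkhs_bessel]. *)
Lemma grid_quadrature (D : set E) (x0 : E) (eta : R) :
  compact D -> D x0 -> 0 < eta ->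
  exists (J : finType) (pt : J -> E) (w : J -> R),
  [/\ forall j, D (pt j), forall j, 0 <= w j, \sum_j w j = fine (mu D) &
    forall (F : E -> R) (e : R), bounded_mfun D F ->
      (forall x y, D x -> D y -> (forall i, `|x ord0 i - y ord0 i| < eta) ->
        `|F x - F y| <= e) ->
      `|\int[mu]_(x in D) F x - \sum_j w j * F (pt j)| <= e * fine (mu D)].
Proof.
move=> cD Dx0 eta0; have mD := compact_measurable_rV cD.
have fD := compact_finite_measure_rV cD.
have [B B0 DB] := compact_box cD.
(* Two points of a cube are each within 2B/M of its vertex, hence within eta of each other. *)
pose M := (Num.truncn (4 * B / eta)).+1.
have M0R : 0 < M%:R :> R by rewrite ltr0n.
have Meta : 2 * B / M%:R + 2 * B / M%:R < eta.
  have : 4 * B / eta < M%:R by exact: truncnS_gt.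
  rewrite ltr_pdivrMr// => h; rewrite -mulrDl ltr_pdivrMr//; lra.
have [Q [c [mQ Q1 Qc]]] := grid_partition B0 (ltn0Sn _ : (0 < M)%N) DB.
(* A cube that misses D gets the node x0, with weight 0. *)
have /choice[pt Hpt] (t : {ffun 'I_d -> 'I_M}) : exists y, D y /\
    ((exists x, D x /\ Q t x) -> Q t y).
  have [[x [Dx Qx]]|nx] := pselect (exists x, D x /\ Q t x).
    by exists x; split.
  by exists x0; split => // /nx.
have bi t : bounded_mfun D (\1_(Q t) : E -> R).
  split; first by apply: measurable_indic.
  by exists 1 => x _; rewrite indicE; case: (_ \in _); rewrite ?normr1 ?normr0.
exists {ffun 'I_d -> 'I_M}, pt, (fun t => \int[mu]_(x in D) \1_(Q t) x); split.
- by move=> t; have [] := Hpt t.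
- by move=> t; apply: Rintegral_ge0 => x _; rewrite indicE ler0n.
- rewrite -(Rintegral_sum_bounded mD fD)//.
  transitivity (\int[mu]_(x in D) (1 : R));
    last by rewrite Rintegral_cst// mul1r.
  by apply: eq_Rintegral => x /set_mem Dx; exact: Q1.
move=> F e bF HF.
have bterm t : bounded_mfun D (fun x => \1_(Q t) x * (F x - F (pt t))).
  apply: bounded_mfunM => //; apply: bounded_mfunB => //.
  exact: bounded_mfun_cst.
have bc t : bounded_mfun D (fun x : E => F (pt t) * \1_(Q t) x).
  exact: bounded_mfunZ.
have -> : \int[mu]_(x in D) F x - \sum_t (\int[mu]_(x in D) \1_(Q t) x) * F (pt
  t) =
    \int[mu]_(x in D) \sum_t \1_(Q t) x * (F x - F (pt t)).
  have -> : \sum_t (\int[mu]_(x in D) \1_(Q t) x) * F (pt t) =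
      \int[mu]_(x in D) \sum_t F (pt t) * \1_(Q t) x.
    rewrite (Rintegral_sum_bounded mD fD)//; apply: eq_bigr => t _.
    by rewrite (RintegralZ_bounded mD fD)// mulrC.
  rewrite -RintegralB//; last 2 first.
  - exact: (bounded_mfun_integrable mD fD).
  - by apply: (bounded_mfun_integrable mD fD); exact: bounded_mfun_sum.
  apply: eq_Rintegral => x /set_mem Dx.
  rewrite -[X in X - _]mul1r -{1}(Q1 _ Dx) mulr_suml -sumrB.
  by apply: eq_bigr => t _; ring.
apply: norm_Rintegral_le => //; first exact: bounded_mfun_sum.
move=> x Dx; apply: le_trans (ler_norm_sum _ _ _) _.
have -> : e = \sum_t \1_(Q t) x * e by rewrite -mulr_suml Q1// mul1r.
apply: ler_sum => t _; rewrite indicE.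
case: (boolP (x \in Q t)) => [/set_mem Qx|_]; last by rewrite !mul0r normr0.
rewrite !mul1r; have [Dp Qp] := Hpt t; apply: HF => // i.
have {}Qp : Q t (pt t) by apply: Qp; exists x.
apply: le_lt_trans (ler_distD (c t ord0 i) _ _) _.
apply: le_lt_trans Meta; apply: lerD; first exact: Qc.
by rewrite distrC; exact: Qc.
Qed.

End quadrature.

(** * Weighted Bessel inequality in the native space *)

Section rkhs_bessel.
Context {R : realType} {d : nat}.
Local Notation E := 'rV[R]_d.
Local Notation mu := (lebesgue_rV R d).
Variables (Omega : set E) (nu : R) (lambda : nat -> R) (phi : nat -> E -> R).
Hypotheses (cO : compact Omega) (pO : (0 < mu Omega)%E) (nu0 : 0 < nu)
  (d0 : (0 < d)%N).
Hypothesis eig : mercer_system Omega (matern_kernel nu) lambda phi.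
Variable N : rkhs (restr_kernel Omega (matern_kernel nu)).
Local Notation Psi := (@matern_kernel R d nu).
Local Notation coef := (fourier_coef Omega phi).

Let mO := compact_measurable_rV cO.
Let fO := compact_finite_measure_rV cO.
Let diag x : Omega x -> Psi x x = 1 := fun _ => matern_kernel_diag _ x.

Lemma matern_kernel_sym (x y : E) : Psi x y = Psi y x.
Proof. by rewrite /matern_kernel -norm2N opprB. Qed.

Let toO x (Ox : Omega x) : Omega := exist _ x (mem_set Ox).

(* Cauchy-Schwarz in the native space turns the continuity of [matern] at [0]
   into a modulus of continuity for the kernel. *)
Let kernel_dist x x' y : Omega x -> Omega x' -> Omega y ->
  (Psi y x - Psi y x') ^+ 2 <= 2 * (1 - Psi x x').
Proof.
move=> Ox Ox' Oy.
have := kernel_dist_sqr_le N (toO Ox) (toO Ox') (toO Oy).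
rewrite /restr_kernel /= (diag Ox) (diag Ox') (diag Oy) (matern_kernel_sym x y).
rewrite (matern_kernel_sym x' y) (matern_kernel_sym x' x) mul1r => H.
by apply: le_trans H _; lra.
Qed.

Let kernel_modulus e : 0 < e -> exists2 del : R, 0 < del &
  forall x x' y, Omega x -> Omega x' -> Omega y ->
    (forall i, `|x ord0 i - x' ord0 i| < del) -> `|Psi y x - Psi y x'| <= e.
Proof.
move=> e0; have e20 : 0 < e ^+ 2 / 2 by rewrite divr_gt0// exprn_gt0.
have [del del0 Hdel] := matern_near0 nu0 e20.
have d0R : 0 < d%:R :> R by rewrite ltr0n.
(* Coordinates within del / d give a squared distance below del^2 / d <= del^2. *)
exists (del / d%:R); first by rewrite divr_gt0.
move=> x x' y Ox Ox' Oy xx'.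
rewrite -ler_sqr ?nnegrE ?(ltW e0)// real_normK ?num_real//.
apply: le_trans (kernel_dist Ox Ox' Oy) _.
have : 1 - Psi x x' <= e ^+ 2 / 2; last by lra.
apply: Hdel; rewrite norm2_ge0/=.
rewrite -ltr_sqr ?nnegrE ?norm2_ge0 ?(ltW del0)// norm2_sqr.
apply: (@lt_le_trans _ _ (\sum_(i < d) (del / d%:R) ^+ 2)).
  rewrite ltr_sum//; first by apply/hasP; exists (Ordinal d0);
    rewrite ?mem_index_enum.
  move=> i _; rewrite !mxE -real_normK ?num_real//.
  by rewrite ltrXn2r ?nnegrE ?divr_ge0 ?(ltW del0)//; exact: xx'.
rewrite sumr_const card_ord -[_ *+ d]mulr_natl expr_div_n mulrCA.
rewrite ler_piMr ?sqr_ge0// expr2 invfM mulrA mulfV ?gt_eqF// mul1r.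
by rewrite invf_le1// ler1n.
Qed.

(** Let T be the integral operator, u = sum_j (c_j / lambda_j) phi_j and v = T u = sum_j c_j phi_j.
    In L2, <g, u> and <u, T u> both equal the sum S on the left. Cauchy-Schwarz for g and T u in the
    native space would read <g, u>^2 <= K <u, T u>, that is S^2 <= K S; it is proved for Riemann
    sums, with an error that tends to 0. *)
Lemma rkhs_bessel (g : E -> R) (m : nat) :
  {within Omega, continuous g} -> rkhs_carrier N (restr Omega g) ->
  \sum_(0 <= j < m) coef g j ^+ 2 / lambda j <=
    rkhs_dot N (restr Omega g) (restr Omega g).
Proof.
move=> cg Ng; set K := rkhs_dot N _ _.
have K0 : 0 <= K by exact: rkhs_dot_ge0.
have [x0 Ox0] : exists x, Omega x.
  apply/not_existsP => nO; have O0 : Omega = set0 by apply/seteqP;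
    split => x // /nO.
  by move: pO; rewrite O0 measure0 ltxx.
have bg : bounded_mfun Omega g by exact: (continuous_bounded_mfun mO cO).
pose u (x : E) : R := \sum_(0 <= j < m) (coef g j / lambda j) * phi j x.
pose v (x : E) : R := \sum_(0 <= j < m) coef g j * phi j x.
have csum (c : nat -> R) :
    {within Omega, continuous (fun x : E => \sum_(0 <= j < m) c j * phi j x)}.
  move=> x; apply: cvg_big => // [|j _]; first exact: add_continuous.
  by apply: cvgM; [exact: cvg_cst|exact: (mercer_continuous eig)].
have cu : {within Omega, continuous u} by exact: csum.
have cv : {within Omega, continuous v} by exact: csum.
have bu : bounded_mfun Omega u by exact: (continuous_bounded_mfun mO cO).
have bv : bounded_mfun Omega v by exact: (continuous_bounded_mfun mO cO).
set S := \sum_(0 <= j < m) _.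
have l0 j : lambda j != 0 by rewrite gt_eqF// (mercer_gt0 eig).
have S0 : 0 <= S.
  by apply: sumr_ge0 => j _; rewrite divr_ge0 ?sqr_ge0// ltW// (mercer_gt0 eig).
have Igu : \int[mu]_(x in Omega) (g x * u x) = S.
  rewrite (Rintegral_sum_phi mO fO cO eig)//; apply: eq_bigr => j _.
  by rewrite expr2 mulrAC.
have Iuv : \int[mu]_(x in Omega) (u x * v x) = S.
  rewrite (Rintegral_sum_phi mO fO cO eig)// /S !big_nat.
  apply: eq_bigr => j /andP[_ jm].
  by rewrite (fourier_coef_sum mO fO cO eig) jm expr2 mulrA.
have Tu y : Omega y -> \int[mu]_(x in Omega) (Psi y x * u x) = v y.
  move=> Oy; rewrite (Rintegral_sum_phi mO fO cO eig)//; last first.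
    exact: (mercer_bounded mO cO eig diag).
  apply: eq_bigr => j _.
  have -> : coef (Psi y) j = lambda j * phi j y.
    rewrite -(mercer_eigen eig)//; apply: eq_Rintegral => x _.
    by rewrite mulrC.
  by rewrite mulrA divfK.
have [U [U0 HU]] : exists U, 0 <= U /\ forall x, Omega x -> `|u x| <= U.
  have [_ [U HU]] := bu; exists U; split => //.
  exact: le_trans (normr_ge0 _) (HU _ Ox0).
set V := fine (mu Omega); have V0 : 0 < V by rewrite fine_gt0// pO.
have Psi1 x y : Omega x -> Omega y -> `|Psi x y| <= 1.
  move=> Ox Oy; have := kernel_sqr_le N (toO Ox) (toO Oy).
  rewrite /restr_kernel /= (diag Ox) (diag Oy) mul1r => H.
  by rewrite -ler_sqr ?nnegrE// real_normK ?num_real// expr1n.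
(* 2 V S comes from the quadrature of <g, u>, and V + U V^2 from that of <u, T u>, whose outer and
   inner integrals are both replaced by sums. *)
have main e : 0 < e -> S ^+ 2 - K * S <= e * (2 * V * S + K * (V + U * V ^+ 2)).
  move=> e0.
  have cgu : {within Omega, continuous (fun x => g x * u x)}.
    by move=> x; apply: cvgM; [exact: cg|exact: cu].
  have cuv : {within Omega, continuous (fun x => u x * v x)}.
    by move=> x; apply: cvgM; [exact: cu|exact: cv].
  have e20 : 0 < e / 2 by rewrite divr_gt0.
  (* The variation allowed to the kernel, which gets multiplied by |u| <= U; adding 1 covers U =
     0. *)
  have eU0 : 0 < e / 2 / (U + 1) by rewrite divr_gt0// ltr_wpDl.
  have [d1 d10 H1] := compact_uniformly_continuous cO cgu e0.
  have [d2 d20 H2] := compact_uniformly_continuous cO cuv e0.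
  have [d3 d30 H3] := compact_uniformly_continuous cO cu e20.
  have [d4 d40 H4] := kernel_modulus eU0.
  pose eta := Num.min (Num.min d1 d2) (Num.min d3 d4).
  have eta0 : 0 < eta by rewrite !lt_min d10 d20 d30.
  have lt_eta (a : R) : a < eta -> [/\ a < d1, a < d2, a < d3 & a < d4].
    by rewrite !lt_min => /andP[/andP[-> ->] /andP[-> ->]].
  have [J [pt [w [Opt w0 w1 quad]]]] := grid_quadrature cO Ox0 eta0.
  (* A Riemann sum for T u, written as a finite combination of kernel sections. *)
  pose l := [seq (w j * u (pt j), toO (Opt j)) | j <- index_enum J].
  have CS := rkhs_cauchy_schwarz l Ng.
  rewrite -/K !big_map /= in CS.
  set A := \sum_j _ in CS.
  have {}CS : A ^+ 2 <= K * \sum_j w j * u (pt j) *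
      \sum_i w i * (Psi (pt j) (pt i) * u (pt i)).
    apply: le_trans CS _; rewrite le_eqVlt; apply/orP; left; apply/eqP.
    congr (_ * _); apply: eq_bigr => j _; rewrite kernel_combE big_map;
      congr (_ * _).
    by apply: eq_bigr => i _; rewrite /restr_kernel /=; ring.
  pose s j := \sum_i w i * (Psi (pt j) (pt i) * u (pt i)).
  have sv j : `|v (pt j) - s j| <= e * V.
    rewrite -Tu//; apply: quad.
      by apply: bounded_mfunM => //; exact: (mercer_bounded mO cO eig diag).
    move=> x y Ox Oy xy; have Op := Opt j.
    have -> (a b p q : R) : a * p - b * q = a * (p - q) + q * (a - b) by ring.
    apply: le_trans (ler_normD _ _) _; rewrite !normrM.
    have -> : e = 1 * (e / 2) + U * (e / 2 / (U + 1)) + e / 2 / (U + 1).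
      by field; rewrite gt_eqF// ltr_wpDl.
    rewrite -[leLHS]addr0; apply: lerD; last exact: ltW.
    apply: lerD; apply: ler_pM => //.
    - exact: Psi1.
    - by apply: H3 => // i; have [] := lt_eta _ (xy i).
    - exact: HU.
    - by apply: H4 => // i; have [] := lt_eta _ (xy i).
  have AS : `|S - A| <= e * V.
    have -> : A = \sum_j w j * (g (pt j) * u (pt j)).
      by apply: eq_bigr => j _; rewrite /restr /=; ring.
    rewrite -Igu; apply: (quad (fun x => g x * u x));
      first exact: bounded_mfunM.
    by move=> x y Ox Oy xy; apply: H1 => // i; have [] := lt_eta _ (xy i).
  have BS : \sum_j w j * u (pt j) * s j <= S + e * (V + U * V ^+ 2).
    have Q : `|S - \sum_j w j * (u (pt j) * v (pt j))| <= e * V.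
      rewrite -Iuv; apply: (quad (fun x => u x * v x));
        first exact: bounded_mfunM.
      by move=> x y Ox Oy xy; apply: H2 => // i; have [] := lt_eta _ (xy i).
    have Q' : \sum_j w j * u (pt j) * s j - \sum_j w j * (u (pt j) * v (pt j))
      <=
        V * (U * (e * V)).
      have -> : V * (U * (e * V)) = \sum_j w j * (U * (e * V)).
        by rewrite -mulr_suml w1.
      rewrite -sumrB; apply: ler_sum => j _.
      rewrite mulrA -mulrBr -mulrA; apply: ler_wpM2l => //.
      apply: le_trans (ler_norm _) _; rewrite normrM distrC.
      by apply: ler_pM => //; exact: HU.
    move: Q; rewrite ler_norml => /andP[h1 h2].
    have -> : S + e * (V + U * V ^+ 2) = (S + e * V) + V * (U * (e * V)) by
      ring.
    lra.
  (* (A - S)^2 >= 0 gives A^2 >= S^2 - 2 S (S - A). *)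
  have A2 : S ^+ 2 - 2 * S * (e * V) <= A ^+ 2.
    have := sqr_ge0 (A - S); move: AS; rewrite ler_norml => /andP[h1 h2] h3.
    have : S * (S - A) <= S * (e * V) by apply: ler_wpM2l.
    lra.
  have KB : A ^+ 2 <= K * (S + e * (V + U * V ^+ 2)).
    by apply: le_trans CS _; apply: ler_wpM2l.
  lra.
have SK : S ^+ 2 - K * S <= 0.
  set c := 2 * V * S + K * (V + U * V ^+ 2) in main.
  have c0 : 0 <= c by rewrite addr_ge0// ?mulr_ge0 ?addr_ge0 ?mulr_ge0
    ?exprn_ge0// ltW.
  apply/ler_addgt0Pl => e e0; rewrite addr0.
  have c1 : 0 < c + 1 by rewrite ltr_wpDl.
  apply: le_trans (main (e / (c + 1)) (divr_gt0 e0 c1)) _.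
  by rewrite mulrAC ler_pdivrMr// ler_pM2l// lerDl.
have [->//|Sn0] := eqVneq S 0.
have Sp : 0 < S by rewrite lt_def Sn0.
by move: SK; rewrite expr2 -mulrBl pmulr_lle0// subr_le0.
Qed.

End rkhs_bessel.

(** * The prediction error *)

Section prediction_error.
Context {R : realType} {d : nat}.
Local Notation E := 'rV[R]_d.
Local Notation mu := (lebesgue_rV R d).
Variables (Omega : set E) (nu : R) (lambda : nat -> R) (phi : nat -> E -> R).
Hypotheses (cO : compact Omega) (pO : (0 < mu Omega)%E).
Hypothesis eig : mercer_system Omega (matern_kernel nu) lambda phi.
Local Notation coef := (fourier_coef Omega phi).

Let mO := compact_measurable_rV cO.
Let fO := compact_finite_measure_rV cO.
Let diag x : Omega x -> matern_kernel nu x x = 1 := fun _ => matern_kernel_diag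
  _ x.

Lemma normL2_sqr (g : E -> R) : bounded_mfun Omega g ->
  (normL2 Omega g ^+ 2 = (\int[mu]_(x in Omega) (g x ^+ 2))%R%:E)%E.
Proof.
move=> bg; set I := (\int[mu]_(x in Omega) _)%R.
have I0 : 0 <= I by apply: Rintegral_ge0 => x _; exact: sqr_ge0.
have IE : (\int[mu]_x `| (EFin \o g \_ Omega) x | `^ 2 = I%:E)%E.
  rewrite /I /Rintegral fineK; last first.
    apply: integrable_fin_num => //; apply: (bounded_mfun_integrable mO fO).
    exact: bounded_mfunX.
  rewrite [RHS]integral_mkcond; apply: eq_integral => x _.
  rewrite /= !patchE; case: ifP => _ /=.
    by rewrite powR_mulrn// real_normK ?num_real.
  by rewrite normr0 powR0.
rewrite /normL2 unlock IE poweR_EFin powR12_sqrt// -EFin_expe.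
by rewrite sqr_sqrtr.
Qed.

(** Both rates follow from this, with two bounds b of the tail. The f(phi_j) are uncorrelated with
    variances lambda_j, and for the coefficients c_j the cross term is twice the quadratic one,
    which leaves the tail of Mercer's series. *)
Lemma prediction_error (V : set (E -> R))
    (V_continuous : forall g, V g -> {within Omega, continuous g})
    (disp : measure_display) (T : measurableType disp) (P : probability T R)
    (f : (E -> R) -> {RV P >-> R})
    (f_gp : mean_zero_gaussian_process V f
              (cov_kernel Omega (matern_kernel nu)))
    (n : nat) (g : E -> R) (fhat : T -> R) (b : R) :
  (forall j : 'I_n, V (phi j)) -> V g ->
  is_cond_expectation P (f g) (fun j : 'I_n => f (phi j)) fhat ->
  (forall m, (n <= m)%N -> \sum_(n <= j < m) lambda j * coef g j ^+ 2 <= b) ->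
  ('E_P[fun w => ((f g w - fhat w) ^+ 2)%R] <= b%:E)%E.
Proof.
move=> Vphi Vg Hf Hb; have [_ f0 fK] := f_gp.
have bg : bounded_mfun Omega g.
  by apply: (continuous_bounded_mfun mO cO); exact: V_continuous.
have bphi := bm_phi mO cO eig.
have := @mse_linear_combination _ T R P n (f g) (fun j : 'I_n => f (phi j)) fhat
  (fun j => coef g j) (cov_kernel Omega (matern_kernel nu) g g)
  (fun j => lambda j * coef g j) (fun i j => lambda i * (j == i)%:R).
move=> /(_ (f0 _ Vg) (fun j => f0 _ (Vphi j)) (fK _ _ Vg Vg)) H.
apply: le_trans (H _ _ Hf) _.
- move=> j; rewrite fK//; congr EFin.
  exact: (cov_kernel_phi mO fO cO eig diag).
- move=> i j; rewrite fK//; congr EFin.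
  rewrite (cov_kernel_phi mO fO cO eig diag)//; congr (_ * _).
  by rewrite /fourier_coef (mercer_orthonormal eig).
rewrite lee_fin; apply: le_trans (cov_kernel_tail mO fO cO eig diag bg Hb).
rewrite big_mkord.
have -> : \sum_(i < n) \sum_(j < n) coef g i * coef g j * (lambda i * (j ==
  i)%:R) =
    \sum_(i < n) lambda i * coef g i ^+ 2.
  apply: eq_bigr => i _; rewrite (bigD1 i)//= eqxx big1 ?addr0; last first.
    by move=> j /negPf ->; rewrite !mulr0.
  by rewrite mulr1; ring.
have -> : \sum_(j < n) coef g j * (lambda j * coef g j) =
    \sum_(i < n) lambda i * coef g i ^+ 2.
  by apply: eq_bigr => i _; ring.
lra.
Qed.

End prediction_error.

Theorem corollary1 (R : realType) (d : nat) (d_gt0 : (0 < d)%N)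
    (Omega : set 'rV[R]_d)
    (Omega_compact : compact Omega)
    (Omega_convex : convex_set Omega)
    (Omega_pos : (0 < lebesgue_rV R d Omega)%E)
    (V : set ('rV[R]_d -> R))
    (V_continuous : forall g, V g -> {within Omega, continuous g})
    (nu : R) (nu_gt0 : 0 < nu)
    (d' : measure_display) (T : measurableType d') (P : probability T R)
    (f : ('rV[R]_d -> R) -> {RV P >-> R})
    (f_gp : mean_zero_gaussian_process V f
              (cov_kernel Omega (matern_kernel nu)))
    (lambda : nat -> R) (phi : nat -> 'rV[R]_d -> R)
    (eig : mercer_system Omega (matern_kernel nu) lambda phi) :
  (exists C1 : R, 0 < C1 /\
     forall n : nat, (0 < n)%N -> (forall j : 'I_n, V (phi j)) ->
     forall (g : 'rV[R]_d -> R) (fhat : T -> R), V g ->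
       is_cond_expectation P (f g) (fun j : 'I_n => f (phi j)) fhat ->
       ('E_P[fun w => ((f g w - fhat w) ^+ 2)%R] <=
          C1%:E * normL2 Omega g ^+ 2
            * (n%:R `^ (- (2 * nu / d%:R)))%R%:E)%E)
  /\
  (forall N : rkhs (restr_kernel Omega (matern_kernel nu)),
   exists C2 : R, 0 < C2 /\
     forall n : nat, (0 < n)%N -> (forall j : 'I_n, V (phi j)) ->
     forall (g : 'rV[R]_d -> R) (fhat : T -> R), V g ->
       rkhs_carrier N (restr Omega g) ->
       is_cond_expectation P (f g) (fun j : 'I_n => f (phi j)) fhat ->
       ('E_P[fun w => ((f g w - fhat w) ^+ 2)%R] <=
          (C2 * rkhs_norm N (restr Omega g) ^+ 2
            * n%:R `^ (- (4 * nu / d%:R)))%R%:E)%E).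
Proof.
have [C C0 HC] := eigenvalue_decay Omega_compact Omega_pos nu_gt0 d_gt0 eig.
have mO := compact_measurable_rV Omega_compact.
have fO := compact_finite_measure_rV Omega_compact.
have bm g : V g -> bounded_mfun Omega g.
  move=> Vg; apply: (continuous_bounded_mfun mO Omega_compact).
  exact: V_continuous.
have l0 j : 0 < lambda j by exact: (mercer_gt0 eig).
pose c g := fourier_coef Omega phi g.
split; [|move=> N].
  (* As indices start at 0, the data are phi_0, ..., phi_(n-1) and lambda_n is the largest
     eigenvalue of the tail. *)
  exists C; split => // n n0 Vphi g fhat Vg Hf.
  rewrite normL2_sqr//; last exact: bm.
  rewrite -!EFinM; apply: (prediction_error Omega_compact eig
    V_continuous f_gp Vphi Vg Hf) => m nm.
  apply: (@le_trans _ _ (lambda n * \sum_(n <= j < m) c g j ^+ 2)).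
    rewrite mulr_sumr !big_nat; apply: ler_sum => j /andP[nj _].
    by apply: ler_wpM2r; [exact: sqr_ge0|exact: (mercer_nonincreasing eig)].
  rewrite [leRHS]mulrAC; apply: ler_pM => //.
  - exact: ltW.
  - by apply: sumr_ge0 => j _; exact: sqr_ge0.
  - exact: HC.
  - apply: le_trans (bessel mO fO Omega_compact eig m (bm _ Vg)).
    rewrite [leRHS](big_cat_nat (leq0n n) nm)/= lerDr.
    by apply: sumr_ge0 => j _; exact: sqr_ge0.
(* Writing lambda_j c_j^2 = lambda_j^2 (c_j^2 / lambda_j) brings in the eigenvalue bound twice,
   hence the square and the doubled rate. *)
exists (C ^+ 2); split; first by rewrite exprn_gt0.
move=> n n0 Vphi g fhat Vg Ng Hf.
apply: (prediction_error Omega_compact eig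
  V_continuous f_gp Vphi Vg Hf) => m nm.
rewrite sqr_sqrtr; last exact: rkhs_dot_ge0.
apply: (@le_trans _ _ (lambda n ^+ 2 * \sum_(n <= j < m) c g j ^+ 2 / lambda
  j)).
  rewrite mulr_sumr !big_nat; apply: ler_sum => j /andP[nj _].
  have lj := mercer_nonincreasing eig nj.
  have -> : lambda j * fourier_coef Omega phi g j ^+ 2 =
      lambda j ^+ 2 * (c g j ^+ 2 / lambda j).
    by rewrite /c; field; rewrite gt_eqF.
  apply: ler_wpM2r; first by rewrite divr_ge0 ?sqr_ge0// ltW.
  by apply: lerXn2r => //; rewrite nnegrE ltW.
have -> : n%:R `^ (- (4 * nu / d%:R)) = (n%:R `^ (- (2 * nu / d%:R))) ^+ 2 :> R.
  rewrite -powR_mulrn ?powR_ge0// -powRrM; congr (_ `^ _).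
  by field; rewrite gt_eqF ?ltr0n.
rewrite [leRHS]mulrAC -exprMn; apply: ler_pM => //.
- exact: sqr_ge0.
- by apply: sumr_ge0 => j _; rewrite divr_ge0 ?sqr_ge0// ltW.
- rewrite lerXn2r ?nnegrE ?HC// ?(ltW (l0 n))//.
  by rewrite mulr_ge0 ?powR_ge0// ltW.
- apply: le_trans (rkhs_bessel Omega_compact Omega_pos nu_gt0 d_gt0 eig m
    (V_continuous _ Vg) Ng).
  rewrite [leRHS](big_cat_nat (leq0n n) nm)/= lerDr.
  by apply: sumr_ge0 => j _; rewrite divr_ge0 ?sqr_ge0// ltW.
Qed.
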